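(* There is a constant $c(p,\gamma)<\infty$, independent of $N$ and of $k$, such that for all $N\ge2$ and all $k\in\{1,\ldots,N-1\}$, with $\bar x=(k-\tfrac12)p\ell^2/R$, $$P_N\bigl(K(\bar x;z_1,\ldots,z_N)=0\bigr)\ge 1/c(p,\gamma)>0 .$$
   Context: Setting. Let $R,\ell>0$, $p\in\mathbb{N}$ and $\gamma=\ell/R$. $\mathcal{Z}=\mathbb{R}\times[0,2\pi R]$, with $z=x+iy$. Laughlin's function. $$\Psi_N(z_1,\ldots,z_N)=\kappa_N\prod_{j<k}\bigl(e^{z_k/R}-e^{z_j/R}\bigr)^p\exp\Bigl(-\frac{1}{2\ell^2}\sum_k x_k^2\Bigr),$$ with $\kappa_N>0$. Probability measure. $P_N$ is the probability measure on $\mathcal{Z}^N$ with density proportional to $|\Psi_N(z_1,\ldots,z_N)|^2$. Particle excess function. For $\bar x=(k-\tfrac12)p\ell^2/R$ with $k\in\{1,\ldots,N-1\}$, $$K(\bar x;z_1,\ldots,z_N)=\#\{j:x_j\le\bar x\}-k .$$ *)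

(* Defs.v *)
From HB Require Import structures.
From mathcomp Require Import all_boot all_order all_algebra.
From mathcomp Require Import all_classical all_reals all_analysis.
From mathcomp Require Import complex.
Set Implicit Arguments. Unset Strict Implicit. Unset Printing Implicit Defensive.
Import Order.TTheory GRing.Theory Num.Theory.
Local Open Scope ring_scope.
Local Open Scope classical_set_scope.

Section Laughlin.
Variable R : realType.

Definition cexp (z : R[i]) : R[i] :=
  Complex (expR (complex.Re z) * cos (complex.Im z)) (expR (complex.Re z) * sin (complex.Im z)).

Definition cabs2 (w : R[i]) : R := complex.Re w ^+ 2 + complex.Im w ^+ 2.

(* A configuration (z_1,...,z_N) is a list of N points z_j = x_j + i y_j,
   stored as pairs (x_j, y_j); z_{j+1} = nth (0,0) s j. *)
Definition zpt (s : seq (R * R)) (j : nat) : R[i] :=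
  Complex (nth (0, 0) s j).1 (nth (0, 0) s j).2.
Definition xco (s : seq (R * R)) (j : nat) : R := (nth (0, 0) s j).1.

Definition Psi (N p : nat) (Rr ell kappa : R) (s : seq (R * R)) : R[i] :=
  (kappa%:C)%C *
  (\prod_(j < N) \prod_(k < N | (j < k)%N)
      (cexp ((Rr^-1)%:C%C * zpt s k) - cexp ((Rr^-1)%:C%C * zpt s j)) ^+ p) *
  ((expR (- (1 / (2 * ell ^+ 2)) * \sum_(k < N) xco s k ^+ 2))%:C)%C.

Fixpoint iintZ (n : nat) (Rr : R) (f : seq (R * R) -> \bar R) : \bar R :=
  match n with
  | 0%N => f [::]
  | n'.+1 =>
    (\int[lebesgue_measure]_(x in [set: R])
      (\int[lebesgue_measure]_(y in `[0%R, (2 * pi * Rr)%R])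
         iintZ n' Rr (fun s => f ((x, y) :: s))))%E
  end.

Definition PN (N p : nat) (Rr ell kappa : R) (E : seq (R * R) -> bool) : R :=
  fine (iintZ N Rr (fun s => ((E s)%:R * cabs2 (Psi N p Rr ell kappa s))%:E)) /
  fine (iintZ N Rr (fun s => (cabs2 (Psi N p Rr ell kappa s))%:E)).

Definition Kexcess (N k : nat) (xbar : R) (s : seq (R * R)) : int :=
  (#|[set j : 'I_N | xco s j <= xbar]|%:Z - k%:Z)%R.

End Laughlin.

(* Main.v *)
Require Import Defs.
From HB Require Import structures.
From mathcomp Require Import all_boot all_order all_algebra.
From mathcomp Require Import mpoly.
From mathcomp Require Import all_classical all_reals all_analysis.
From mathcomp Require Import measurable_realfun complex.
From mathcomp Require Import ring lra.
Set Implicit Arguments. Unset Strict Implicit. Unset Printing Implicit Defensive.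
Import Order.TTheory GRing.Theory Num.Theory.
Import numFieldNormedType.Exports.
Local Open Scope ring_scope.

(* With u_j = exp (z_j / R), expand prod_{j<k} (u_k - u_j)^p = sum_m a(m) u^m.
   Integrating over the angles turns the law of the x_j into a mixture: m is
   drawn with weight a(m)^2 exp (gamma^2 |m|^2), and given m the x_j are
   independent Gaussians centred at m_j ell^2 / R.

   Fix a set S of k indices and let W be the part of the expansion in which
   every cross factor (u_r - u_l)^p, with l in S and r outside S, is replaced
   by u_r^p. The exponents of W satisfy majorization inequalities on both
   sides of the cut, so the i-th one counted from the cut lies at distance at
   least p (i + 1) / 2 from k p - p / 2; hence, given such an m, exactly the
   particles of S lie to the left of xbar with probability bounded below.

   It remains to bound the weight of all m having their k smallest exponents
   on S by a constant times the weight of W. Expanding the cross factors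
   expresses a(m) as a sum over subsets T of cross edges of shifted
   coefficients of W, and a Schur test applies: the Gaussian weights make the
   matrix element of T decay exponentially in the sum over its edges of the
   ranks of the endpoints, both when ranks are taken in the target exponent
   (by Hardy's inequality) and in the source exponent. *)

(** * Hardy's inequality and ranks *)

(** The sum of the squared running means is at most twice their pairing with [b], so Young's
    inequality [b a <= b^2 + a^2 / 4] lets half of the pairing be absorbed on the left. *)
Lemma hardy_sum (F : realFieldType) (b : nat -> F) (n : nat) :
  \sum_(i < n) b i * ((\sum_(j < i.+1) b j) / i.+1%:R) <=
  2 * \sum_(i < n) b i ^+ 2.
Proof.
pose a i := (\sum_(j < i.+1) b j) / i.+1%:R.
(* The extra term, the squared total over [n], makes the induction close: what remains is a perfect
   square divided by [n]. *)
have sq_le : \sum_(i < n) a i ^+ 2 + (\sum_(j < n) b j) ^+ 2 / n%:R <=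
    2 * \sum_(i < n) b i * a i.
  elim: n => [|n IHn]; first by rewrite !big_ord0 expr0n mul0r mulr0 addr0.
  rewrite [X in X + _ <= _]big_ord_recr [X in _ <= 2 * X]big_ord_recr /=.
  move: IHn; set B := \sum_(j < n) b j.
  have Ea : \sum_(j < n.+1) b j = n.+1%:R * a n.
    by rewrite /a mulrCA divff ?mulr1 // pnatr_eq0.
  have Eb : b n = n.+1%:R * a n - B by rewrite -Ea big_ord_recr /= -/B addrAC subrr add0r.
  rewrite Ea Eb -(natr1 n) => IHn.
  have -> : ((n%:R + 1) * a n) ^+ 2 / (n%:R + 1) = (n%:R + 1) * a n ^+ 2.
    by field; rewrite natr1 pnatr_eq0.
  suff : 0 <= n%:R * a n ^+ 2 - 2 * a n * B + B ^+ 2 / n%:R by nra.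
  case: (posnP n) => [n0|n_gt0].
    by rewrite {1}/B n0 big_ord0 mul0r mulr0 subr0 add0r invr0 mulr0.
  have n_neq0 : n%:R != 0 :> F by rewrite pnatr_eq0 -lt0n.
  have -> : n%:R * a n ^+ 2 - 2 * a n * B + B ^+ 2 / n%:R =
            (n%:R * a n - B) ^+ 2 / n%:R by field.
  by rewrite divr_ge0 ?sqr_ge0 ?ler0n.
have {}sq_le : \sum_(i < n) a i ^+ 2 <= 2 * \sum_(i < n) b i * a i.
  by apply: le_trans sq_le; rewrite lerDl divr_ge0 ?sqr_ge0 ?ler0n.
have : \sum_(i < n) b i * a i <=
       \sum_(i < n) b i ^+ 2 + 4^-1 * \sum_(i < n) a i ^+ 2.
  rewrite mulr_sumr -big_split /=; apply: ler_sum => i _.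
  have := sqr_ge0 (b i - a i / 2); nra.
rewrite /a in sq_le *; lra.
Qed.

(** The sort breaks ties, so distinct elements of [S] get distinct ranks [0, 1, ...]; sums of
    [q ^+ rank] over [S] are then bounded by a geometric series, whatever [D] and the size of
    [S]. *)
Definition srank (R : realFieldType) (I : finType) (S : {set I}) (D : I -> R)
    (i : I) : nat :=
  index i (sort (fun i j => D i <= D j) (enum S)).

Section Ranking.
Variables (R : realFieldType) (I : finType) (S : {set I}) (D : I -> R).

Let s := sort (fun i j => D i <= D j) (enum S).

Let s_uniq : uniq s. Proof. by rewrite sort_uniq enum_uniq. Qed.

Let mem_s i : (i \in s) = (i \in S).
Proof. by rewrite mem_sort mem_enum. Qed.

Lemma big_srank (T : Type) (idx : T) (op : Monoid.com_law idx) (x0 : I)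
    (G : I -> nat -> T) :
  \big[op/idx]_(i in S) G i (srank S D i) =
  \big[op/idx]_(i < size s) G (nth x0 s i) i.
Proof.
rewrite -big_enum (perm_big s) /=; last by rewrite perm_sym perm_sort.
rewrite (big_nth x0) big_mkord; apply: eq_bigr => i _.
by rewrite /srank -/s index_uniq.
Qed.

Lemma sum_srank_geometric (q : R) : 0 <= q -> q < 1 ->
  \sum_(i in S) q ^+ srank S D i <= (1 - q)^-1.
Proof.
move=> q_ge0 q_lt1; have subq_gt0 : 0 < 1 - q by rewrite subr_gt0.
have [->|[x0 x0S]] := set_0Vmem S.
  by rewrite big_set0 invr_ge0 ltW.
rewrite (big_srank _ x0 (fun _ k => q ^+ k)).
rewrite -[leRHS]mul1r ler_pdivlMr // mulrC.
have -> : (1 - q) * \sum_(i < size s) q ^+ i = 1 - q ^+ size s.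
  by rewrite -(opprB q) mulNr -subrX1 opprB.
by rewrite gerBl exprn_ge0.
Qed.

(* The value of [D] at rank [i] dominates the mean of its [i.+1] smallest
   values, which the hypothesis on sums bounds from below. *)
Lemma srank_le_mean (c : R) (b : I -> R) (x0 : I) :
    (forall A : {set I}, A \subset S ->
      c * (#|A|%:R * (#|A|%:R - 1)) <= \sum_(j in A) (D j + b j)) ->
  forall i, (i < size s)%N ->
    c * i%:R <= D (nth x0 s i) + (\sum_(j < i.+1) b (nth x0 s j)) / i.+1%:R.
Proof.
move=> sum_ge i lt_is; pose A := [set x in take i.+1 s].
have uA : uniq (take i.+1 s) by rewrite take_uniq.
have szA : size (take i.+1 s) = i.+1 by rewrite size_takel.
have cA : #|A| = i.+1 by rewrite cardsE (card_uniqP uA).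
have sumA (f : I -> R) : \sum_(j in A) f j = \sum_(j < i.+1) f (nth x0 s j).
  rewrite (eq_bigl (mem (take i.+1 s))); last by move=> j; rewrite inE.
  rewrite -big_uniq // (big_nth x0) szA big_mkord.
  by apply: eq_bigr => j _; rewrite nth_take.
have AS : A \subset S.
  by apply/fintype.subsetP => x; rewrite inE => /mem_take; rewrite mem_s.
have i1_gt0 : 0 < i.+1%:R :> R by rewrite ltr0n.
have D_ge : \sum_(j < i.+1) D (nth x0 s j) <= i.+1%:R * D (nth x0 s i).
  rewrite mulr_natl -[X in _ *+ X]card_ord -sumr_const; apply: ler_sum => j _.
  have le_tr : transitive (fun i j => D i <= D j) by move=> y x z; apply: le_trans.
  have le_rf : reflexive (fun i j => D i <= D j) by move=> x; exact: lexx.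
  have s_sorted : sorted (fun i j => D i <= D j) s.
    by apply: sort_sorted => x y; exact: le_total.
  have le_ji : (j <= i)%N by rewrite -ltnS.
  apply: (sorted_leq_nth le_tr le_rf x0 s_sorted) => //; rewrite inE //.
  exact: leq_ltn_trans lt_is.
have := sum_ge _ AS; rewrite sumA big_split /= cA.
set B := \sum_(j < i.+1) b _ => H.
rewrite -(ler_pM2l i1_gt0) mulrDr mulrCA [_ * (B / _)]mulrCA divff ?gt_eqF //.
rewrite mulr1; have -> : i%:R = i.+1%:R - 1 :> R by rewrite -(natr1 i) addrK.
by apply: le_trans H _; rewrite lerD2r.
Qed.

Lemma srank_le (c : R) :
    (forall A : {set I}, A \subset S ->
      c * (#|A|%:R * (#|A|%:R - 1)) <= \sum_(j in A) D j) ->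
  forall i, i \in S -> c * (srank S D i)%:R <= D i.
Proof.
move=> sum_ge i iS.
have H := @srank_le_mean c (fun=> 0) i.
have {}H : c * (srank S D i)%:R <= D (nth i s (srank S D i)) +
    (\sum_(j < (srank S D i).+1) 0) / (srank S D i).+1%:R.
  apply: H; last by rewrite index_mem mem_s.
  by move=> A AS; under eq_bigr do rewrite addr0; exact: sum_ge.
by move: H; rewrite big1 // mul0r addr0 nth_index // mem_s.
Qed.

(** The mean of [b] in the bound at a single rank may be large, but weighted by [b] and summed over
    [S] it is controlled by Hardy's inequality. *)
Lemma sum_srank_le (c : R) (b : I -> R) :
    (forall i, i \in S -> 0 <= b i) ->
    (forall A : {set I}, A \subset S ->
      c * (#|A|%:R * (#|A|%:R - 1)) <= \sum_(j in A) (D j + b j)) ->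
  \sum_(i in S) b i * (c * (srank S D i)%:R) <=
  \sum_(i in S) b i * D i + 2 * \sum_(i in S) b i ^+ 2.
Proof.
move=> b_ge0 sum_ge.
have [->|[x0 x0S]] := set_0Vmem S; first by rewrite !big_set0 mulr0 addr0.
rewrite (big_srank _ x0 (fun i k => b i * (c * k%:R))).
rewrite (big_srank _ x0 (fun i _ => b i * D i)).
rewrite (big_srank _ x0 (fun i _ => b i ^+ 2)).
apply: le_trans (_ : _ <= \sum_(i < size s) b (nth x0 s i) * D (nth x0 s i) +
  \sum_(i < size s) b (nth x0 s i) *
    ((\sum_(j < i.+1) b (nth x0 s j)) / i.+1%:R)) _; last first.
  by rewrite lerD2l (hardy_sum (fun i => b (nth x0 s i))).
rewrite -big_split /=; apply: ler_sum => i _; rewrite -mulrDr.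
apply: ler_wpM2l; last exact: srank_le_mean.
by apply: b_ge0; rewrite -mem_s mem_nth.
Qed.

End Ranking.

Lemma prod_add_subset (A : comNzRingType) (E : finType) (X : {set E})
    (F G : E -> A) :
  \prod_(e in X) (F e + G e) =
  \sum_(T : {set E} | T \subset X)
     \prod_(e in X) (if e \in T then F e else G e).
Proof.
rewrite big_mkcond /=.
have -> : \prod_e (if e \in X then F e + G e else 1) =
          \prod_e ((if e \in X then F e else 0) + (if e \in X then G e else 1)).
  by apply: eq_bigr => e _; case: ifP; rewrite ?add0r.
rewrite bigA_distr [RHS]big_mkcond /=; apply: eq_bigr => T _.
case: ifPn => [TX|/fintype.subsetPn[e eT eX]].
  rewrite [RHS]big_mkcond /=; apply: eq_bigr => e _.
  by case: ifP => [eT|_]; case: ifPn => // /negP []; exact: (fintype.subsetP TX).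
by rewrite (bigD1 e) //= eT (negPf eX) mul0r.
Qed.

(** * Cross edges and the energy of a shift *)

Section CrossEdges.
Variables (R : realType) (I : finType) (S : {set I}) (p : nat).

(** The last component numbers the [p] copies of the factor of a pair, so subsets correspond to the
    terms of the expanded cross product. *)
Definition cross_edges : {set I * I * 'I_p} :=
  [set e | (e.1.1 \in S) && (e.1.2 \notin S)].

Definition ldeg (T : {set I * I * 'I_p}) (i : I) : nat :=
  \sum_(e in T) (e.1.1 == i).

Definition rdeg (T : {set I * I * 'I_p}) (i : I) : nat :=
  \sum_(e in T) (e.1.2 == i).

Variable T : {set I * I * 'I_p}.
Hypothesis TX : T \subset cross_edges.

Let lS e : e \in T -> e.1.1 \in S.
Proof. by move=> /(fintype.subsetP TX); rewrite inE => /andP[]. Qed.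

Let rS e : e \in T -> e.1.2 \in ~: S.
Proof. by move=> /(fintype.subsetP TX); rewrite !inE => /andP[]. Qed.

Lemma sum_ldeg (f : I -> R) :
  \sum_(i in S) (ldeg T i)%:R * f i = \sum_(e in T) f e.1.1.
Proof.
under eq_bigr => i _ do rewrite natr_sum mulr_suml.
rewrite exchange_big /=; apply: eq_bigr => e /lS eS.
rewrite (bigD1 e.1.1) //= eqxx mul1r big1 ?addr0 // => i /andP[_ /negPf ne].
by rewrite eq_sym ne mul0r.
Qed.

Lemma sum_rdeg (f : I -> R) :
  \sum_(i in ~: S) (rdeg T i)%:R * f i = \sum_(e in T) f e.1.2.
Proof.
under eq_bigr => i _ do rewrite natr_sum mulr_suml.
rewrite exchange_big /=; apply: eq_bigr => e /rS eS.
rewrite (bigD1 e.1.2) //= eqxx mul1r big1 ?addr0 // => i /andP[_ /negPf ne].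
by rewrite eq_sym ne mul0r.
Qed.

Variables (n n0 : I -> R).
Hypothesis nl : forall i, i \in S -> n i = n0 i + (ldeg T i)%:R.
Hypothesis nr : forall i, i \in ~: S -> n i = n0 i - (rdeg T i)%:R.

(** The loss in the sum of squares when [n0] is shifted to [n] along [T]. It is written with the
    shifted exponents because their ordering across the cut makes the first sum nonnegative. *)
Definition cross_energy : R :=
  2 * \sum_(e in T) (n e.1.2 - n e.1.1) +
  \sum_(i in S) (ldeg T i)%:R ^+ 2 + \sum_(i in ~: S) (rdeg T i)%:R ^+ 2.

Lemma sum_sqr_cross : \sum_i n i ^+ 2 = \sum_i n0 i ^+ 2 - cross_energy.
Proof.
have split2 (f : I -> R) : \sum_i f i = \sum_(i in S) f i + \sum_(i in ~: S) f i.
  rewrite (bigID (mem S)) /=; congr (_ + _).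
  by apply: eq_bigl => i; rewrite inE.
rewrite /cross_energy sumrB -sum_ldeg -sum_rdeg !split2 mulrBr !mulr_sumr.
apply/eqP; rewrite -subr_eq0; apply/eqP.
have -> : \sum_(i in S) n i ^+ 2 = \sum_(i in S) n0 i ^+ 2 +
    \sum_(i in S) (2 * ((ldeg T i)%:R * n i)) -
    \sum_(i in S) (ldeg T i)%:R ^+ 2.
  rewrite -big_split -sumrB /=; apply: eq_bigr => i iS.
  by rewrite (nl iS); ring.
have -> : \sum_(i in ~: S) n i ^+ 2 = \sum_(i in ~: S) n0 i ^+ 2 -
    \sum_(i in ~: S) (2 * ((rdeg T i)%:R * n i)) -
    \sum_(i in ~: S) (rdeg T i)%:R ^+ 2.
  rewrite -!sumrB /=; apply: eq_bigr => i iS.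
  by rewrite (nr iS); ring.
by ring.
Qed.

Hypothesis n_le : forall i j, i \in S -> j \in ~: S -> n i <= n j.

(** With [k = #|S|], the exponents [p (k - 1)] and [p k] are adjacent to the cut in the arrangement
    [0, p, 2 p, ...]; [Dl] and [Dr] are signed distances from them, counted away from the cut. *)
Let Dl (m : I -> R) i := p%:R * (#|S|%:R - 1) - m i.
Let Dr (m : I -> R) i := m i - p%:R * #|S|%:R.

Hypothesis maj_l : forall A : {set I}, A \subset S ->
  p%:R / 2 * (#|A|%:R * (#|A|%:R - 1)) <= \sum_(i in A) Dl n0 i.
Hypothesis maj_r : forall A : {set I}, A \subset ~: S ->
  p%:R / 2 * (#|A|%:R * (#|A|%:R - 1)) <= \sum_(i in A) Dr n0 i.

Let sum_diff_ge0 : 0 <= \sum_(e in T) (n e.1.2 - n e.1.1).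
Proof. by apply: sumr_ge0 => e eT; rewrite subr_ge0 n_le ?lS ?rS. Qed.

(** For ranks of the target [n], majorization is available only after adding the degrees, since
    [Dl n0 = Dl n + ldeg T] on [S] and similarly on the right. Hardy's inequality with the degrees
    as [b] charges this to the squared degrees in the energy. *)
Lemma cross_energy_ge_rank :
  p%:R / 4 * \sum_(e in T)
     ((srank S (Dl n) e.1.1).+1%:R + (srank (~: S) (Dr n) e.1.2).+1%:R) <=
  cross_energy.
Proof.
have Hl : \sum_(i in S) (ldeg T i)%:R * (p%:R / 2 * (srank S (Dl n) i)%:R) <=
    \sum_(i in S) (ldeg T i)%:R * Dl n i + 2 * \sum_(i in S) (ldeg T i)%:R ^+ 2.
  apply: sum_srank_le => [i _|A AS]; first by rewrite ler0n.
  rewrite (eq_bigr (Dl n0)) ?maj_l // => i /(fintype.subsetP AS) iS.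
  by rewrite /Dl nl //; ring.
have Hr : \sum_(i in ~: S) (rdeg T i)%:R * (p%:R / 2 * (srank (~: S) (Dr n) i)%:R) <=
    \sum_(i in ~: S) (rdeg T i)%:R * Dr n i +
    2 * \sum_(i in ~: S) (rdeg T i)%:R ^+ 2.
  apply: sum_srank_le => [i _|A AS]; first by rewrite ler0n.
  rewrite (eq_bigr (Dr n0)) ?maj_r // => i /(fintype.subsetP AS) iS.
  by rewrite /Dr nr //; ring.
rewrite (sum_ldeg (fun i => p%:R / 2 * (srank S (Dl n) i)%:R)) in Hl.
rewrite (sum_rdeg (fun i => p%:R / 2 * (srank (~: S) (Dr n) i)%:R)) in Hr.
rewrite (sum_ldeg (Dl n)) in Hl; rewrite (sum_rdeg (Dr n)) in Hr.
(* The [p] lost per edge is the gap between [p (k - 1)] and [p k]; it supplies the successors on the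
   two ranks. *)
have E : \sum_(e in T) Dl n e.1.1 + \sum_(e in T) Dr n e.1.2 =
    \sum_(e in T) (n e.1.2 - n e.1.1) - p%:R * \sum_(e in T) 1.
  rewrite mulr_sumr -big_split -sumrB /=; apply: eq_bigr => e _.
  by rewrite /Dl /Dr; ring.
have -> : p%:R / 4 * \sum_(e in T) ((srank S (Dl n) e.1.1).+1%:R +
      (srank (~: S) (Dr n) e.1.2).+1%:R) =
    2^-1 * (\sum_(e in T) (p%:R / 2 * (srank S (Dl n) e.1.1)%:R) +
    \sum_(e in T) (p%:R / 2 * (srank (~: S) (Dr n) e.1.2)%:R) +
    p%:R * \sum_(e in T) 1) :> R.
  rewrite !mulr_sumr -!big_split /= mulr_sumr.
  by apply: eq_bigr => e _; rewrite -(natr1 (srank S _ _)) -(natr1 (srank (~: S) _ _)); field.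
rewrite /cross_energy; have := sum_diff_ge0; lra.
Qed.

(** For ranks of the source [n0], majorization applies directly, edge by edge. The distances summed
    over [T], plus [p] per edge, equal the energy minus one nonnegative copy of the differences. *)
Lemma cross_energy_ge_rank0 :
  p%:R / 4 * \sum_(e in T)
     ((srank S (Dl n0) e.1.1).+1%:R + (srank (~: S) (Dr n0) e.1.2).+1%:R) <=
  cross_energy.
Proof.
have E : \sum_(e in T) (Dl n0 e.1.1 + Dr n0 e.1.2 + p%:R) =
    \sum_(e in T) (n e.1.2 - n e.1.1) +
    \sum_(i in S) (ldeg T i)%:R ^+ 2 + \sum_(i in ~: S) (rdeg T i)%:R ^+ 2.
  rewrite (eq_bigr (fun i => (ldeg T i)%:R * (ldeg T i)%:R)) // sum_ldeg.
  rewrite [X in _ = _ + X](eq_bigr (fun i => (rdeg T i)%:R * (rdeg T i)%:R)) //.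
  rewrite sum_rdeg -!big_split /=; apply: eq_bigr => e eT.
  by rewrite /Dl /Dr (nl (lS eT)) (nr (rS eT)); ring.
apply: le_trans (_ : _ <= \sum_(e in T) (Dl n0 e.1.1 + Dr n0 e.1.2 + p%:R)) _.
  rewrite mulr_sumr; apply: ler_sum => e eT.
  have := srank_le maj_l (lS eT); have := srank_le maj_r (rS eT).
  have : 0 <= p%:R :> R by rewrite ler0n.
  rewrite -(natr1 (srank S _ _)) -(natr1 (srank (~: S) _ _)).
  have : 0 <= p%:R * (srank S (Dl n0) e.1.1)%:R :> R by rewrite mulr_ge0.
  have : 0 <= p%:R * (srank (~: S) (Dr n0) e.1.2)%:R :> R by rewrite mulr_ge0.
  lra.
rewrite E /cross_energy; have := sum_diff_ge0; lra.
Qed.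

End CrossEdges.

(** The sum over [T] is a product of factors [1 + f e], bounded by an exponential, and the sum of
    [f] is [p] times a product of two geometric series in the ranks. Hence a bound uniform in [S]
    and [I]. *)
Lemma sum_cross_subsets_le (R : realType) (I : finType) (S : {set I}) (p : nat)
    (D1 D2 : I -> R) (q : R) : 0 <= q -> q < 1 ->
  \sum_(T : {set I * I * 'I_p} | T \subset cross_edges S p)
    q ^+ (\sum_(e in T) ((srank S D1 e.1.1).+1 + (srank (~: S) D2 e.1.2).+1)) <=
  expR (p%:R * (q / (1 - q)) ^+ 2).
Proof.
move=> q_ge0 q_lt1.
pose f (e : I * I * 'I_p) : R :=
  q ^+ (srank S D1 e.1.1).+1 * q ^+ (srank (~: S) D2 e.1.2).+1.
have f_ge0 e : 0 <= f e by rewrite mulr_ge0 ?exprn_ge0.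
apply: le_trans (_ : _ <= \prod_(e in cross_edges S p) (f e + 1)) _.
  rewrite prod_add_subset; apply: ler_sum => T TX.
  rewrite -big_mkcondr /= [leRHS](eq_bigl (mem T)) => [|e] /=; last first.
    by rewrite andbC; case: (boolP (e \in T)) => // /(fintype.subsetP TX).
  by rewrite -prodrXr; under eq_bigr do rewrite exprD.
apply: le_trans (_ : _ <= expR (\sum_(e in cross_edges S p) f e)) _.
  rewrite expR_sum; apply: ler_prod => e _.
  by rewrite addr_ge0 ?f_ge0 //= addrC expR_ge1Dx.
rewrite ler_expR.
have -> : \sum_(e in cross_edges S p) f e = p%:R *
    ((\sum_(i in S) q ^+ (srank S D1 i).+1) *
     (\sum_(j in ~: S) q ^+ (srank (~: S) D2 j).+1)).
  rewrite big_distrlr /= pair_big /= mulr_sumr.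
  rewrite (eq_bigl (fun e => ((e.1.1 \in S) && (e.1.2 \in ~: S)) && true)).
    rewrite -(pair_big (fun x : I * I => (x.1 \in S) && (x.2 \in ~: S))
       (fun _ : 'I_p => true) (fun x k => f (x, k))) /=.
    by apply: eq_bigr => x _; rewrite /f /= sumr_const card_ord mulr_natl.
  by move=> e; rewrite !inE andbT.
rewrite ler_wpM2l ?ler0n // expr2.
have bnd (A : {set I}) (D : I -> R) : \sum_(i in A) q ^+ (srank A D i).+1 <= q / (1 - q).
  under eq_bigr => i _ do rewrite exprS.
  rewrite -mulr_sumr ler_wpM2l //; exact: sum_srank_geometric.
by apply: ler_pM; rewrite ?bnd // sumr_ge0 // => i _; rewrite exprn_ge0.
Qed.

Lemma weighted_cauchy_schwarz (R : realFieldType) (I : finType) (P : pred I)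
    (x e : I -> R) : (forall i, P i -> 0 < e i) ->
  (\sum_(i | P i) x i) ^+ 2 <=
  (\sum_(i | P i) e i) * \sum_(i | P i) x i ^+ 2 / e i.
Proof.
move=> e_gt0; set E := \sum_(i | P i) e i; set X := \sum_(i | P i) x i.
have [i0 Pi0|P0] := pickP P; last first.
  by rewrite /X /E !big_pred0 // expr0n mul0r.
have E_gt0 : 0 < E.
  rewrite /E (bigD1 i0) //= ltr_pwDl ?e_gt0 // sumr_ge0 // => i /andP[Pi _].
  by rewrite ltW ?e_gt0.
have sum_sqr t : \sum_(i | P i) e i * (x i / e i - t) ^+ 2 =
    \sum_(i | P i) x i ^+ 2 / e i - 2 * t * X + t ^+ 2 * E.
  rewrite /E /X !mulr_sumr -sumrB -big_split /=; apply: eq_bigr => i Pi.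
  by field; rewrite gt_eqF ?e_gt0.
(* The weighted variance of [x / e] about its mean [X / E] is nonnegative. *)
have : 0 <= \sum_(i | P i) e i * (x i / e i - X / E) ^+ 2.
  by apply: sumr_ge0 => i Pi; rewrite mulr_ge0 ?sqr_ge0 // ltW ?e_gt0.
rewrite sum_sqr.
have -> : (X / E) ^+ 2 * E = X ^+ 2 / E by field; rewrite gt_eqF.
have -> : 2 * (X / E) * X = 2 * (X ^+ 2 / E) by field; rewrite gt_eqF.
by move=> H; rewrite mulrC -ler_pdivrMr //; lra.
Qed.

Lemma ler_sum_support (R : numDomainType) (I : eqType) (s s' : seq I)
    (P : pred I) (F : I -> R) : uniq s -> uniq s' -> (forall x, 0 <= F x) ->
    (forall x, x \in s -> F x != 0 -> x \in s') ->
  \sum_(x <- s | P x) F x <= \sum_(x <- s' | P x) F x.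
Proof.
move=> us us' F_ge0 ss'.
rewrite (bigID (fun x => x \in s')) [leRHS](bigID (fun x => x \in s)) /=.
rewrite [X in _ + X <= _]big1_seq => [|x /andP[/andP[_ xs'] xs]]; last first.
  by apply/eqP; apply: contraNT xs'; exact: ss'.
rewrite lerD ?sumr_ge0 // -big_filter -[leRHS]big_filter.
rewrite (perm_big [seq x <- s' | P x & x \in s]) //.
apply: uniq_perm; rewrite ?filter_uniq // => x; rewrite !mem_filter.
by case: (P x); case: (x \in s); case: (x \in s').
Qed.

Lemma sum_ltn_sym (R : nmodType) (N : nat) (P : rel 'I_N)
    (f : 'I_N -> 'I_N -> R) : ssrbool.symmetric P ->
  \sum_(j < N) \sum_(k < N | (j < k)%N && P j k) (f j k + f k j) =
  \sum_(j < N) \sum_(k < N | (k != j) && P j k) f j k.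
Proof.
move=> Psym.
under eq_bigr => j _ do rewrite big_split /=.
rewrite big_split /=.
have -> : \sum_(j < N) \sum_(k < N | (j < k)%N && P j k) f k j =
          \sum_(j < N) \sum_(k < N | (k < j)%N && P j k) f j k.
  rewrite (exchange_big_dep predT) //=; apply: eq_bigr => j _.
  by apply: eq_bigl => k; rewrite Psym.
rewrite -big_split /=; apply: eq_bigr => j _.
rewrite [RHS](bigID (fun k : 'I_N => (j < k)%N)) /=; congr (_ + _).
  apply: eq_bigl => k; rewrite -val_eqE /=; case: ltngtP; rewrite ?andbF ?andbT //.
apply: eq_bigl => k; rewrite -val_eqE /=; case: ltngtP; rewrite ?andbF ?andbT //.
Qed.

(** * The Laughlin polynomial and its exponents on both sides of a cut *)

Section LaughlinPolynomial.
Variables (R : realType) (N p : nat).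
Implicit Types (S A : {set 'I_N}) (m : 'X_{1..N}).

Definition laughlin_poly : {mpoly R[N]} :=
  \prod_(j < N) \prod_(k < N | (j < k)%N) ('X_k - 'X_j) ^+ p.

Definition same_side S : rel 'I_N := fun j k => (j \in S) == (k \in S).

Definition block_poly S : {mpoly R[N]} :=
  \prod_(j < N) \prod_(k < N | (j < k)%N && same_side S j k) ('X_k - 'X_j) ^+ p.

(** Cross factors are oriented from [S] outwards, at the cost of a sign for each reversed pair.
    Coefficients are later squared, so [c ^+ 2 = 1] records enough. *)
Lemma laughlin_poly_factor S : exists2 c : R, c ^+ 2 = 1 &
  laughlin_poly = c *: (block_poly S *
    \prod_(e in cross_edges S p) ('X_(e.1.2) - 'X_(e.1.1))).
Proof.
pose F (x : 'I_N * 'I_N) : {mpoly R[N]} := ('X_(x.2) - 'X_(x.1)) ^+ p.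
(* The pairs whose endpoint in [S] has the larger index: exactly those whose factor must be
   reversed. *)
pose P (x : 'I_N * 'I_N) := (x.1 \notin S) && (x.2 \in S) && (x.1 < x.2)%N.
have F_swap (x : 'I_N * 'I_N) : F x = (-1) ^+ p *: F (x.2, x.1).
  by rewrite /F /= -(opprB ('X_(x.1))) -scaleN1r exprZn.
exists (\prod_(x | P x) (-1) ^+ p).
  rewrite -prodrXl big1 // => x _.
  by rewrite sqrr_sign.
have crossE : \prod_(e in cross_edges S p) ('X_(e.1.2) - 'X_(e.1.1)) =
    \prod_(x | (x.1 \in S) && (x.2 \notin S)) F x.
  rewrite (eq_bigl (fun e => ((e.1.1 \in S) && (e.1.2 \notin S)) && true)).
    rewrite -(pair_big (fun x : 'I_N * 'I_N => (x.1 \in S) && (x.2 \notin S))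
       (fun _ : 'I_p => true) (fun x k => 'X_(x.2) - 'X_(x.1))) /=.
    by apply: eq_bigr => x _; rewrite prodr_const card_ord.
  by move=> e; rewrite inE andbT.
rewrite crossE /laughlin_poly.
transitivity (block_poly S * \prod_(j < N)
    \prod_(k < N | (j < k)%N && ~~ same_side S j k) F (j, k)).
  by rewrite -big_split; apply: eq_bigr => j _; rewrite (bigID (same_side S j)).
rewrite scalerAr; congr (_ * _).
set c : R := \prod_(x | P x) _.
rewrite pair_big_dep /= (bigID (fun x => x.1 \in S)) /=.
rewrite [in RHS](bigID (fun x : 'I_N * 'I_N => (x.1 < x.2)%N)) /=.
rewrite scalerAr; congr (_ * _).
  apply: eq_bigl => x; rewrite /same_side.
  by case: (x.1 \in S); case: (x.2 \in S); rewrite ?andbT ?andbF.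
rewrite [in RHS](reindex (fun x : 'I_N * 'I_N => (x.2, x.1))) /=; last first.
  by exists (fun x : 'I_N * 'I_N => (x.2, x.1)) => -[].
have PE : (fun x : 'I_N * 'I_N => [&& (x.1 < x.2)%N & ~~ same_side S x.1 x.2] &&
    (x.1 \notin S)) =1 P.
  move=> x; rewrite /P /same_side.
  by case: (x.1 \in S); case: (x.2 \in S); rewrite ?andbT ?andbF.
have PE' : (fun x : 'I_N * 'I_N => (x.2 \in S) && (x.1 \notin S) &&
    ~~ (x.2 < x.1)%N) =1 P.
  move=> x; rewrite /P.
  case: (boolP (x.1 \in S)) => x1; case: (boolP (x.2 \in S)) => x2 //=.
  rewrite -leqNgt leq_eqVlt; case: eqP => // /val_inj x12.
  by move: x1; rewrite x12 x2.
rewrite (eq_bigl _ _ PE) [in RHS](eq_bigl _ _ PE') /c -scaler_prod.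
by apply: eq_bigr => x _; rewrite -F_swap.
Qed.

Lemma msupp_prod_ge (I : Type) (r : seq I) (Q : pred I)
    (f : I -> {mpoly R[N]}) (c : 'I_N -> R) (lo : I -> R) :
    (forall i, Q i -> forall m, m \in msupp (f i) ->
      lo i <= \sum_j c j * (m j)%:R) ->
  forall m, m \in msupp (\prod_(i <- r | Q i) f i) ->
    \sum_(i <- r | Q i) lo i <= \sum_j c j * (m j)%:R.
Proof.
move=> lo_le; elim: r => [|i r IHr] m.
  rewrite !big_nil msupp1 inE => /eqP ->.
  by rewrite big1 // => j _; rewrite mnm0E mulr0.
rewrite !big_cons; case: ifP => [Qi|_]; last exact: IHr.
move=> /msuppM_le /allpairsP[[m1 m2] /= [m1i m2r ->]].
have -> : \sum_j c j * ((m1 + m2)%MM j)%:R =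
    \sum_j c j * (m1 j)%:R + \sum_j c j * (m2 j)%:R.
  by rewrite -big_split; apply: eq_bigr => j _; rewrite mnmDE natrD mulrDr.
by apply: lerD; [exact: lo_le | exact: IHr].
Qed.

(** Each of the [p] factors of a pair contributes [c j] or [c k] to the linear functional, and
    [lo j k] is below both. Signed indicators for [c] turn this into majorization. *)
Lemma msupp_block_ge S (c : 'I_N -> R) (lo : 'I_N -> 'I_N -> R) :
    (forall j k, same_side S j k -> lo j k <= c j /\ lo j k <= c k) ->
  forall m, m \in msupp (block_poly S) ->
    p%:R * \sum_(j < N) \sum_(k < N | (j < k)%N && same_side S j k) lo j k <=
    \sum_j c j * (m j)%:R.
Proof.
move=> lo_le m /msupp_prod_ge H; rewrite mulr_sumr; apply: H => j _ {}m.
move=> /msupp_prod_ge H; rewrite mulr_sumr; apply: H => k /andP[_ jk] {}m.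
rewrite -[p in ('X_k - 'X_j) ^+ p]card_ord -prodr_const.
move=> /(@msupp_prod_ge _ _ _ _ c (fun=> lo j k)).
rewrite sumr_const card_ord mulr_natl; apply=> i _ {}m.
move=> /msuppB_le; rewrite mem_cat !msuppX !inE.
have sumU l : \sum_j0 c j0 * ((U_(l)%MM : 'X_{1..N}) j0)%:R = c l.
  rewrite (bigD1 l) //= mnm1E eqxx mulr1 big1 ?addr0 // => i' /negPf ne.
  by rewrite mnm1E eq_sym ne mulr0.
have [le_j le_k] := lo_le _ _ jk.
by case/orP => /eqP ->; rewrite sumU.
Qed.

Lemma sum_pairs_in S A : A \subset S \/ A \subset ~: S ->
  \sum_(j < N) \sum_(k < N | (j < k)%N && same_side S j k)
    ((j \in A)%:R * (k \in A)%:R) = #|A|%:R * (#|A|%:R - 1) / 2 :> R.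
Proof.
move=> AS.
pose f (j k : 'I_N) : R := (j \in A)%:R * (k \in A)%:R / 2.
have ff j k : (j \in A)%:R * (k \in A)%:R = f j k + f k j by rewrite /f; field.
under eq_bigr => j _ do under eq_bigr => k _ do rewrite ff.
rewrite sum_ltn_sym; last by move=> j k; rewrite /same_side eq_sym.
have AE j k : j \in A -> k \in A -> same_side S j k.
  case: AS => /fintype.subsetP AS /AS jS /AS kS; move: jS kS; rewrite /same_side ?inE.
    by move=> -> ->.
  by move=> /negPf -> /negPf ->.
have -> : \sum_(j < N) \sum_(k < N | (k != j) && same_side S j k) f j k =
    \sum_(j in A) \sum_(k in A | k != j) 2^-1.
  rewrite [RHS]big_mkcond; apply: eq_bigr => j _; rewrite /f.
  case: ifPn => jA; last by rewrite big1 // => k _; rewrite !mul0r.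
  rewrite [LHS]big_mkcond [RHS]big_mkcond; apply: eq_bigr => k _.
  case: (boolP (k \in A)) => kA /=; last by rewrite mulr0 mul0r if_same.
  by rewrite (AE _ _ jA kA) andbT !mul1r.
have -> : \sum_(j in A) \sum_(k in A | k != j) 2^-1 =
    \sum_(j in A) ((#|A|%:R - 1) / 2) :> R.
  apply: eq_bigr => j jA; have := sumr_const (mem A) (2^-1 : R).
  by rewrite (bigD1 j) //= => /(canRL (addKr _)) ->; rewrite -mulr_natl; ring.
by rewrite sumr_const -[LHS]mulr_natl mulrA.
Qed.

Lemma sum_pairs_meeting S A : A \subset S ->
  \sum_(j < N) \sum_(k < N | (j < k)%N && same_side S j k)
    ((j \in A)%:R + (k \in A)%:R) = #|A|%:R * (#|S|%:R - 1) :> R.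
Proof.
move=> /fintype.subsetP AS; rewrite (sum_ltn_sym (fun j k => (j \in A)%:R)).
  have -> : \sum_(j < N) \sum_(k < N | (k != j) && same_side S j k)
      (j \in A)%:R = \sum_(j in A) (#|S|%:R - 1) :> R.
    rewrite [RHS]big_mkcond; apply: eq_bigr => j _.
    case: ifPn => jA; last by rewrite big1.
    have := sumr_const (mem S) (1 : R); rewrite (bigD1 j) ?AS //=.
    move=> /(canRL (addKr _)); rewrite addrC => <-; apply: eq_bigl => k.
    by rewrite /same_side (AS _ jA) andbC; case: (k \in S).
  by rewrite sumr_const -[LHS]mulr_natl.
by move=> j k; rewrite /same_side eq_sym.
Qed.

(* [T] collects the factors of the cross product in which the term of the
   variable indexed by [S] is chosen when the product is expanded. *)
Definition edge_mnm S (T : {set 'I_N * 'I_N * 'I_p}) : 'X_{1..N} :=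
  (\big[+%MM/0%MM]_(e in cross_edges S p)
     (if e \in T then U_(e.1.1) else U_(e.1.2)))%MM.

Lemma edge_mnm_l S (T : {set 'I_N * 'I_N * 'I_p}) i :
  T \subset cross_edges S p -> i \in S -> edge_mnm S T i = ldeg T i.
Proof.
move=> /fintype.subsetP TX iS.
rewrite mnm_sumE /ldeg big_mkcond [RHS]big_mkcond /=; apply: eq_bigr => e _.
case: (boolP (e \in T)) => eT; first by rewrite TX // mnm1E.
case: ifPn => //; rewrite inE => /andP[_ eS]; rewrite mnm1E.
by case: eqP => // ei; rewrite ei iS in eS.
Qed.

Lemma edge_mnm_r S (T : {set 'I_N * 'I_N * 'I_p}) i :
  T \subset cross_edges S p -> i \in ~: S ->
  (edge_mnm S T i + rdeg T i = p * #|S|)%N.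
Proof.
move=> /fintype.subsetP TX; rewrite inE => iS.
have -> : (p * #|S| = \sum_(e in cross_edges S p) (e.1.2 == i))%N.
  under eq_bigr => e _ do rewrite -[nat_of_bool _]/((if e.1.2 == i then 1 else 0)%N).
  rewrite -big_mkcondr sum1_card.
  have -> : #|[pred e in cross_edges S p | e.1.2 == i]| =
            #|finset.setX (finset.setX S [set i]) [set: 'I_p]|.
    apply: eq_card => -[[j k] l]; rewrite !inE /= andbT.
    by case: eqP => [->|]; rewrite ?iS ?andbT ?andbF.
  by rewrite !cardsX cards1 cardsT card_ord muln1 mulnC.
rewrite mnm_sumE /rdeg [X in (_ + X)%N](big_setID (cross_edges S p)) /=.
rewrite [X in (_ + (_ + X))%N]big1 => [|e /setDP[/TX eX]]; last by rewrite eX.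
rewrite addn0 [in X in (_ + X)%N](eq_bigl (fun e => (e \in cross_edges S p) && (e \in T))).
  rewrite [X in (_ + X)%N]big_mkcondr /= -big_split /=; apply: eq_bigr => e eX.
  case: ifP => eT; rewrite mnm1E ?addn0 //.
  case: eqP => // ei; move: eX; rewrite inE => /andP[eS _].
  by rewrite ei (negPf iS) in eS.
by move=> e; rewrite inE andbC.
Qed.

(* The exponents contributed by the renewal term [T = set0]. *)
Definition bulk_mnm S m : 'X_{1..N} := (m + edge_mnm S finset.set0)%MM.

Lemma bulk_mnm_l S m i : i \in S -> bulk_mnm S m i = m i.
Proof.
move=> iS; rewrite mnmDE edge_mnm_l ?finset.sub0set //.
by rewrite /ldeg big_set0 addn0.
Qed.

Lemma bulk_mnm_r S m i : i \in ~: S -> bulk_mnm S m i = (m i + p * #|S|)%N.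
Proof.
move=> iS; rewrite mnmDE -(@edge_mnm_r _ finset.set0 _ _ iS) ?finset.sub0set //.
by rewrite /rdeg big_set0 addn0.
Qed.

Let sum_indic A (f : 'I_N -> R) :
  \sum_j (j \in A)%:R * f j = \sum_(j in A) f j.
Proof.
rewrite [RHS]big_mkcond; apply: eq_bigr => j _.
by case: ifP; rewrite ?mul1r ?mul0r.
Qed.

Lemma msupp_block_maj_l S m A : m \in msupp (block_poly S) -> A \subset S ->
  p%:R / 2 * (#|A|%:R * (#|A|%:R - 1)) <=
  \sum_(i in A) (p%:R * (#|S|%:R - 1) - (bulk_mnm S m i)%:R) :> R.
Proof.
move=> mB AS.
(* Here [lo] is minus the indicator that the pair meets [A]: the exponents on [A] sum to at most [p]
   times the number of such pairs. *)
have := @msupp_block_ge S (fun j => - (j \in A)%:R)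
  (fun j k => (j \in A)%:R * (k \in A)%:R - ((j \in A)%:R + (k \in A)%:R)) _ _ mB.
have -> : \sum_j - (j \in A)%:R * (m j)%:R = - \sum_(j in A) (m j)%:R :> R.
  by rewrite -sum_indic -sumrN; apply: eq_bigr => j _; rewrite mulNr.
under eq_bigr => j _ do rewrite sumrB.
rewrite sumrB sum_pairs_in ?sum_pairs_meeting //; last by left.
rewrite sumrB sumr_const -[_ *+ #|A|]mulr_natl.
rewrite [X in _ -> _ <= _ - X](eq_bigr (fun i => (m i)%:R)); last first.
  by move=> i /(fintype.subsetP AS) iS; rewrite bulk_mnm_l.
have : forall j k, same_side S j k ->
    (j \in A)%:R * (k \in A)%:R - ((j \in A)%:R + (k \in A)%:R) <= - (j \in A)%:R :> R /\
    (j \in A)%:R * (k \in A)%:R - ((j \in A)%:R + (k \in A)%:R) <= - (k \in A)%:R :> R.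
  by move=> j k _; case: (j \in A); case: (k \in A); split => /=; lra.
move=> lo_le /(_ lo_le); lra.
Qed.

Lemma msupp_block_maj_r S m A : m \in msupp (block_poly S) -> A \subset ~: S ->
  p%:R / 2 * (#|A|%:R * (#|A|%:R - 1)) <=
  \sum_(i in A) ((bulk_mnm S m i)%:R - p%:R * #|S|%:R) :> R.
Proof.
move=> mB AS.
(* Here [lo] indicates that both ends lie in [A]: such factors feed [A] whichever term is chosen. *)
have := @msupp_block_ge S (fun j => (j \in A)%:R)
  (fun j k => (j \in A)%:R * (k \in A)%:R) _ _ mB.
rewrite sum_indic sum_pairs_in; last by right.
rewrite [X in _ -> _ <= X](eq_bigr (fun i => (m i)%:R)); last first.
  move=> i /(fintype.subsetP AS) iS.
  by rewrite bulk_mnm_r // natrD natrM addrK.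
have : forall j k, same_side S j k ->
    (j \in A)%:R * (k \in A)%:R <= (j \in A)%:R :> R /\
    (j \in A)%:R * (k \in A)%:R <= (k \in A)%:R :> R.
  by move=> j k _; case: (j \in A); case: (k \in A); split => /=; lra.
move=> lo_le /(_ lo_le); lra.
Qed.

(** The block polynomial is homogeneous in the variables of [S]: majorization with [A = S] gives the
    upper bound, counting pairs inside [S] the lower one. *)
Lemma msupp_block_sum S m : m \in msupp (block_poly S) ->
  \sum_(i in S) (m i)%:R = p%:R / 2 * (#|S|%:R * (#|S|%:R - 1)) :> R.
Proof.
move=> mB; apply/eqP; rewrite eq_le; apply/andP; split.
  have := msupp_block_maj_l mB (subxx _).
  rewrite sumrB sumr_const -[_ *+ #|S|]mulr_natl.
  rewrite (eq_bigr (fun i => (m i)%:R)); last by move=> i iS; rewrite bulk_mnm_l.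
  lra.
have := @msupp_block_ge S (fun j => (j \in S)%:R)
  (fun j k => (j \in S)%:R * (k \in S)%:R) _ _ mB.
rewrite sum_indic sum_pairs_in; last by left.
have : forall j k, same_side S j k ->
    (j \in S)%:R * (k \in S)%:R <= (j \in S)%:R :> R /\
    (j \in S)%:R * (k \in S)%:R <= (k \in S)%:R :> R.
  by move=> j k _; case: (j \in S); case: (k \in S); split => /=; lra.
move=> lo_le /(_ lo_le); lra.
Qed.

Lemma cross_prod_expand S :
  \prod_(e in cross_edges S p) ('X_(e.1.2) - 'X_(e.1.1)) =
  \sum_(T : {set 'I_N * 'I_N * 'I_p} | T \subset cross_edges S p)
    (\prod_(e in cross_edges S p) (if e \in T then -1 else 1)) *:
    'X_[edge_mnm S T] :> {mpoly R[N]}.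
Proof.
rewrite (eq_bigr (fun e => - 'X_(e.1.1) + 'X_(e.1.2))); last first.
  by move=> e _; rewrite addrC.
rewrite prod_add_subset; apply: eq_bigr => T _.
rewrite /edge_mnm -mprodXE -scaler_prod; apply: eq_bigr => e _.
by case: ifP => _; rewrite ?scaleN1r ?scale1r.
Qed.

Lemma mcoeff_laughlin S : exists2 c : {set 'I_N * 'I_N * 'I_p} -> R,
  forall T, c T ^+ 2 = 1 &
  forall m, laughlin_poly@_m =
    \sum_(T : {set 'I_N * 'I_N * 'I_p} | T \subset cross_edges S p)
      c T * (block_poly S * 'X_[edge_mnm S T])@_m.
Proof.
have [c0 c02 ->] := laughlin_poly_factor S.
exists (fun T : {set 'I_N * 'I_N * 'I_p} =>
  c0 * \prod_(e in cross_edges S p) (if e \in T then -1 else 1)).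
  move=> T; rewrite exprMn c02 mul1r -prodrXl big1 // => e _.
  by case: ifP; rewrite ?sqrrN expr1n.
move=> m; rewrite mcoeffZ cross_prod_expand mulr_sumr raddf_sum mulr_sumr /=.
by apply: eq_bigr => T _; rewrite -scalerAr mcoeffZ mulrA.
Qed.

Lemma msuppMX_split (P : {mpoly R[N]}) (k m : 'X_{1..N}) :
  (P * 'X_[k])@_m != 0 -> exists2 m', m' \in msupp P & m = (k + m')%MM.
Proof. by rewrite -mcoeff_msupp (perm_mem (msuppMX _ _)) => /mapP. Qed.

(** A shift by [T] raises the degree in the variables of [S] by [#|T|], and all block exponents have
    the same degree there. Only the empty [T] reaches [bulk_mnm S m], so nothing cancels its
    coefficient. *)
Lemma mcoeff_laughlin_bulk S m : m \in msupp (block_poly S) ->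
  laughlin_poly@_(bulk_mnm S m) ^+ 2 = (block_poly S)@_m ^+ 2.
Proof.
move=> mB; have [c c2 ->] := mcoeff_laughlin S.
rewrite (bigD1 finset.set0) ?finset.sub0set //= big1 => [|T /andP[TX T0]].
  by rewrite addr0 exprMn c2 mul1r /bulk_mnm addmC mcoeffMX.
apply/eqP; rewrite mulf_eq0; apply/orP; right; apply: contraNT T0.
move=> /msuppMX_split[m' m'B E].
have : \sum_(i in S) (bulk_mnm S m i)%:R =
    \sum_(i in S) ((m' i)%:R + (ldeg T i)%:R * 1) :> R.
  apply: eq_bigr => i iS; rewrite E mnmDE edge_mnm_l // natrD mulr1.
  by rewrite addrC.
rewrite big_split /= sum_ldeg // (msupp_block_sum m'B).
rewrite (eq_bigr (fun i => (m i)%:R)); last by move=> i iS; rewrite bulk_mnm_l.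
rewrite (msupp_block_sum mB) sumr_const => /esym /(canRL (addKr _)).
rewrite addNr => /eqP; rewrite pnatr_eq0 cards_eq0.
by [].
Qed.

(** * Schur test for exponents ordered across the cut *)

Definition ordered_at S m : bool :=
  [forall i in S, forall j in ~: S, (m i <= m j)%N].

Variable g : R.
Hypotheses (g_gt0 : 0 < g) (p_gt0 : (0 < p)%N).

(** The rate is the [p / 4] of the energy bounds times the [g / 2] of the square root of the weight;
    [C] is the resulting bound on row and column sums. *)
Let q := expR (- (g * p%:R / 8)).
Let C := expR (p%:R * (q / (1 - q)) ^+ 2).

Definition mnm_weight m : R := expR (g * \sum_j (m j)%:R ^+ 2).

Let q_lt1 : q < 1.
Proof. by rewrite /q expR_lt1 oppr_lt0 divr_gt0 ?mulr_gt0 ?ltr0n. Qed.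

Let q_ge0 : 0 <= q. Proof. exact: expR_ge0. Qed.

Let energy S T m := @cross_energy R _ S p T (fun i => (m i)%:R).

Section FixedBlock.
Variables (S : {set 'I_N}).
Let X := cross_edges S p.
Let B := block_poly S.

Section OneShift.
Variables (T : {set 'I_N * 'I_N * 'I_p}) (m' : 'X_{1..N}).
Hypotheses (TX : T \subset X) (m'B : m' \in msupp B).
Let m := (edge_mnm S T + m')%MM.
Let m0 := bulk_mnm S m'.

Let ml i : i \in S -> (m i)%:R = (m0 i)%:R + (ldeg T i)%:R :> R.
Proof.
by move=> iS; rewrite /m /m0 mnmDE bulk_mnm_l // edge_mnm_l // natrD addrC.
Qed.

Let mr i : i \in ~: S -> (m i)%:R = (m0 i)%:R - (rdeg T i)%:R :> R.
Proof.
move=> iS; rewrite /m /m0 mnmDE bulk_mnm_r // -(edge_mnm_r TX iS) !natrD.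
by ring.
Qed.

(** The loss of weight is written as a square: one factor serves the row sums, the other the column
    sums. *)
Lemma mnm_weight_shift :
  mnm_weight m = mnm_weight m0 * expR (- (g / 2) * energy S T m) ^+ 2.
Proof.
rewrite /mnm_weight (@sum_sqr_cross _ _ S p T TX _ (fun i => (m0 i)%:R)) //.
by rewrite -expRM_natl -expRD; congr expR; rewrite /energy; field.
Qed.

Hypothesis mS : ordered_at S m.

Let m_le i j : i \in S -> j \in ~: S -> (m i)%:R <= (m j)%:R :> R.
Proof.
move=> iS jS; rewrite ler_nat.
by move: mS => /forall_inP /(_ i iS) /forall_inP /(_ j jS).
Qed.

Let Dl (n : 'X_{1..N}) i : R := p%:R * (#|S|%:R - 1) - (n i)%:R.
Let Dr (n : 'X_{1..N}) i : R := (n i)%:R - p%:R * #|S|%:R.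

Let expR_energy_le (D1 D2 : 'I_N -> R) :
  p%:R / 4 * \sum_(e in T)
     ((srank S D1 e.1.1).+1%:R + (srank (~: S) D2 e.1.2).+1%:R) <= energy S T m ->
  expR (- (g / 2) * energy S T m) <=
  q ^+ (\sum_(e in T) ((srank S D1 e.1.1).+1 + (srank (~: S) D2 e.1.2).+1)).
Proof.
move=> H; rewrite -expRM_natl ler_expR natr_sum.
under eq_bigr do rewrite natrD.
set s := \sum_(e in T) _ in H *.
have := ler_wpM2l (ltW g_gt0) H; lra.
Qed.

Lemma expR_energy_le_row : expR (- (g / 2) * energy S T m) <=
  q ^+ (\sum_(e in T) ((srank S (Dl m) e.1.1).+1 +
                       (srank (~: S) (Dr m) e.1.2).+1)).
Proof.
apply: expR_energy_le; apply: cross_energy_ge_rank; first exact: TX.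
- exact: ml.
- exact: mr.
- exact: m_le.
- by move=> A AS; exact: msupp_block_maj_l.
- by move=> A AS; exact: msupp_block_maj_r.
Qed.

Lemma expR_energy_le_col : expR (- (g / 2) * energy S T m) <=
  q ^+ (\sum_(e in T) ((srank S (Dl m0) e.1.1).+1 +
                       (srank (~: S) (Dr m0) e.1.2).+1)).
Proof.
apply: expR_energy_le; apply: cross_energy_ge_rank0; first exact: TX.
- exact: ml.
- exact: mr.
- exact: m_le.
- by move=> A AS; exact: msupp_block_maj_l.
- by move=> A AS; exact: msupp_block_maj_r.
Qed.

End OneShift.

Let E T m : R := expR (- (g / 2) * energy S T m).

Let E_gt0 T m : 0 < E T m. Proof. exact: expR_gt0. Qed.

Let row_bound m : ordered_at S m ->
  laughlin_poly@_m ^+ 2 * mnm_weight m <=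
  C * \sum_(T : {set 'I_N * 'I_N * 'I_p} | T \subset X)
        (B * 'X_[edge_mnm S T])@_m ^+ 2 / E T m * mnm_weight m.
Proof.
move=> mS; rewrite -mulr_suml mulrA ler_wpM2r ?expR_ge0 //.
have [c c2 ->] := mcoeff_laughlin S; rewrite -/B -/X.
(* Decay of [E T m] is known only when [m] is a shift of an exponent of [B], so vanishing terms are
   dropped before Cauchy-Schwarz. *)
pose P (T : {set 'I_N * 'I_N * 'I_p}) :=
  (T \subset X) && ((B * 'X_[edge_mnm S T])@_m != 0).
have -> : \sum_(T : {set 'I_N * 'I_N * 'I_p} | T \subset X)
    c T * (B * 'X_[edge_mnm S T])@_m =
    \sum_(T | P T) c T * (B * 'X_[edge_mnm S T])@_m.
  rewrite big_mkcondr /=; apply: eq_bigr => T _.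
  by case: eqP => // ->; rewrite mulr0.
have -> : \sum_(T : {set 'I_N * 'I_N * 'I_p} | T \subset X)
    (B * 'X_[edge_mnm S T])@_m ^+ 2 / E T m =
    \sum_(T | P T) (c T * (B * 'X_[edge_mnm S T])@_m) ^+ 2 / E T m.
  rewrite [RHS]big_mkcondr /=; apply: eq_bigr => T _.
  case: eqP => [->|_] /=; first by rewrite expr0n mul0r.
  by rewrite exprMn c2 mul1r.
apply: le_trans (weighted_cauchy_schwarz _ (fun T _ => E_gt0 T m)) _.
rewrite ler_wpM2r //.
  by apply: sumr_ge0 => T _; rewrite divr_ge0 ?sqr_ge0 ?expR_ge0.
apply: le_trans (sum_cross_subsets_le S p
  (fun i => p%:R * (#|S|%:R - 1) - (m i)%:R)
  (fun i => (m i)%:R - p%:R * #|S|%:R) q_ge0 q_lt1).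
rewrite [leRHS](bigID (fun T => (B * 'X_[edge_mnm S T])@_m != 0)) /=.
rewrite -[leLHS]addr0 lerD //; last first.
  by apply: sumr_ge0 => T _; rewrite exprn_ge0.
apply: ler_sum => T /andP[TX /msuppMX_split[m' m'B mE]].
by move: mS; rewrite mE => mS; exact: expR_energy_le_row.
Qed.

(** Cauchy-Schwarz with weights [E T m] costs one factor [C], by the ranks of the target. After
    exchanging sums a single factor [E] survives from [E ^+ 2 / E]; summing it over [T] by the ranks
    of the source costs the second [C]. *)
Lemma ordered_sum_le :
  \sum_(m <- msupp laughlin_poly | ordered_at S m)
    laughlin_poly@_m ^+ 2 * mnm_weight m <=
  C ^+ 2 * \sum_(m <- msupp B) B@_m ^+ 2 * mnm_weight (bulk_mnm S m).
Proof.
apply: le_trans (ler_sum _ (fun m => @row_bound m)) _.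
rewrite -mulr_sumr expr2 -mulrA ler_wpM2l ?expR_ge0 // exchange_big /=.
have col (T : {set 'I_N * 'I_N * 'I_p}) : T \subset X ->
    \sum_(m <- msupp laughlin_poly | ordered_at S m)
      (B * 'X_[edge_mnm S T])@_m ^+ 2 / E T m * mnm_weight m <=
    \sum_(m' <- msupp B | ordered_at S (edge_mnm S T + m')%MM)
      B@_m' ^+ 2 * mnm_weight (bulk_mnm S m') * E T (edge_mnm S T + m')%MM.
  move=> TX; set F := fun m => (B * 'X_[edge_mnm S T])@_m ^+ 2 / E T m * mnm_weight m.
  have F_ge0 m : 0 <= F m.
    by rewrite mulr_ge0 ?expR_ge0 // divr_ge0 ?sqr_ge0 ?expR_ge0.
  apply: le_trans (_ : _ <= \sum_(m <- msupp (B * 'X_[edge_mnm S T]) |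
      ordered_at S m) F m) _.
    apply: ler_sum_support => // m _ Fm; rewrite mcoeff_msupp.
    by apply: contraNneq Fm => m0; rewrite /F m0 expr0n !mul0r.
  rewrite (perm_big _ (msuppMX _ _)) big_map /= big_seq_cond [leRHS]big_seq_cond.
  apply: ler_sum => m' /andP[m'B _]; rewrite /F mcoeffMX mnm_weight_shift // -/(E _ _).
  rewrite le_eqVlt; apply/orP; left; apply/eqP.
  by field; rewrite gt_eqF.
apply: le_trans (ler_sum _ col) _.
rewrite (exchange_big_dep predT) //= mulr_sumr big_seq [leRHS]big_seq.
apply: ler_sum => m' m'B; rewrite -mulr_sumr mulrC ler_wpM2r //.
  by rewrite mulr_ge0 ?sqr_ge0 ?expR_ge0.
apply: le_trans (sum_cross_subsets_le S p
  (fun i => p%:R * (#|S|%:R - 1) - (bulk_mnm S m' i)%:R)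
  (fun i => (bulk_mnm S m' i)%:R - p%:R * #|S|%:R) q_ge0 q_lt1).
rewrite big_mkcondr /=; apply: ler_sum => T TX.
case: ifP => [mS|_]; last by rewrite exprn_ge0.
exact: expR_energy_le_col.
Qed.

End FixedBlock.

End LaughlinPolynomial.

(** * Angular and Gaussian integrals *)

Lemma sin_period (R : realType) (k : int) (x : R) :
  sin (x + k%:~R * (pi *+ 2)) = sin x.
Proof.
have sin_nat (n : nat) (y : R) : sin (y + n%:R * (pi *+ 2)) = sin y.
  elim: n => [|n IHn]; first by rewrite mul0r addr0.
  by rewrite -natr1 mulrDl mul1r addrA sinD2pi.
case: k => n; first exact: sin_nat.
by rewrite -(sin_nat n.+1) NegzE rmorphN /= mulNr addrNK.
Qed.

Section Integrals.
Context {R : realType}.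
Local Notation mu := (@lebesgue_measure R).

Lemma integral_lin_comb (I : Type) (r : seq I) (c : I -> R)
    (D : set (measurableTypeR R)) (f : I -> R -> R) : measurable D ->
    (forall t, mu.-integrable D (EFin \o f t)) ->
  (\int[mu]_(x in D) (\sum_(t <- r) c t * f t x)%:E)%E =
  (\sum_(t <- r) c t * \int[mu]_(x in D) f t x)%:E.
Proof.
move=> mD intf.
transitivity (\int[mu]_(x in D) \sum_(t <- r) ((c t)%:E * (f t x)%:E))%E.
  by apply: eq_integral => x _; rewrite -sumEFin.
rewrite (@integral_sum _ _ _ mu D mD _ (fun t x => (c t)%:E * (f t x)%:E)%E);
  last by move=> t; exact: (integrableZl mD _ (intf t)).
rewrite -sumEFin; apply: eq_bigr => t _.
rewrite integralZl //; last exact: intf.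
by rewrite EFinM /Rintegral fineK // integrable_fin_num //; exact: intf.
Qed.

Lemma integrable_cos_affine (a b phi th : R) :
  mu.-integrable `[a, b]%classic (EFin \o (fun y => cos (phi + th * y))).
Proof.
apply: continuous_compact_integrable; first exact: segment_compact.
apply: continuous_subspaceT => y.
apply: (@continuous_comp _ _ _ (fun y => phi + th * y) cos); last exact: continuous_cos.
by apply: cvgD; [exact: cvg_cst | apply: cvgM; [exact: cvg_cst | exact: cvg_id]].
Qed.

Lemma Rintegral_cos_period (Rr phi : R) (k : int) : 0 < Rr ->
  \int[mu]_(y in `[0, 2 * pi * Rr]%classic) cos (phi + k%:~R / Rr * y) =
  2 * pi * Rr * (k == 0)%:R * cos phi.
Proof.
move=> Rr_gt0.
have L_gt0 : 0 < 2 * pi * Rr by rewrite !mulr_gt0 ?pi_gt0.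
have [->|k_neq0] := eqVneq k 0.
  under eq_Rintegral do rewrite !mul0r addr0.
  rewrite Rintegral_cst //= lebesgue_measure_itv /= lte_fin L_gt0.
  by rewrite oppr0 addr0 /= mulr1 mulrC.
rewrite mulr0 mul0r.
pose th := k%:~R / Rr.
have th_neq0 : th != 0.
  by apply: mulf_neq0; [rewrite intr_eq0 | apply/invr_neq0/lt0r_neq0].
pose F y := th^-1 * sin (phi + th * y).
have dF (y : R) : is_derive y (1 : R) F (cos (phi + th * y)).
  rewrite /F; apply: is_derive_eq.
  by rewrite /GRing.scale /=; field.
have cF : continuous F by move=> y; apply: differentiable_continuous; apply/derivable1_diffP.
rewrite /Rintegral (@continuous_FTC2 _ _ F) //.
- rewrite /F mulr0 addr0 -EFinB /=.
  have -> : th * (2 * pi * Rr) = k%:~R * (pi *+ 2).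
    by rewrite /th; field; rewrite gt_eqF.
  by rewrite sin_period subrr.
- apply: continuous_subspaceT => y.
  apply: (@continuous_comp _ _ _ (fun y => phi + th * y) cos); last exact: continuous_cos.
  by apply: cvgD; [exact: cvg_cst | apply: cvgM; [exact: cvg_cst | exact: cvg_id]].
- split; first by move=> y _; exact: (@ex_derive _ _ _ _ _ _ _ (dF y)).
  + exact/cvg_at_right_filter/cF.
  + exact/cvg_at_left_filter/cF.
- by move=> y _; rewrite derive1E; apply: derive_val.
Qed.

Lemma eq_iintZ (n : nat) (Rr : R) (f g : seq (R * R) -> \bar R) :
  (forall s, size s = n -> f s = g s) -> iintZ n Rr f = iintZ n Rr g.
Proof.
elim: n f g => [|n IHn] f g fg /=; first exact: fg.
apply: eq_integral => x _; apply: eq_integral => y _; apply: IHn => s sn.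
by apply: fg; rewrite /= sn.
Qed.

(** Amplitude [c] and phase [phi] are arbitrary because the induction moves the first particle's
    radial factor into [c] and its angle into [phi]. *)
Lemma iintZ_trig (I : Type) (r : seq I) (n : nat) (Rr : R) : 0 < Rr ->
  forall (c phi : I -> R) (G : I -> nat -> R -> R) (th : I -> nat -> int),
    (forall t j, mu.-integrable [set: R]%classic (EFin \o G t j)) ->
  iintZ n Rr (fun s => (\sum_(t <- r)
     c t * (\prod_(j < n) G t j (xco s j)) *
     cos (phi t + \sum_(j < n) (th t j)%:~R / Rr * (nth (0, 0) s j).2))%:E) =
  (\sum_(t <- r) c t *
     (\prod_(j < n) (2 * pi * Rr * (th t j == 0)%:R * \int[mu]_x G t j x)) *
     cos (phi t))%:E.
Proof.
move=> Rr_gt0; elim: n => [|n IHn] c phi G th intG /=.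
  by congr EFin; apply: eq_bigr => t _; rewrite !big_ord0 addr0.
pose M t := \prod_(j < n) (2 * pi * Rr * (th t j.+1 == 0)%:R *
                           \int[mu]_x G t j.+1 x).
transitivity (\int[mu]_(x in [set: R]%classic)
    (\sum_(t <- r) (c t * M t * (2 * pi * Rr * (th t 0%N == 0)%:R * cos (phi t))) *
       G t 0%N x)%:E)%E; last first.
  rewrite integral_lin_comb //; congr EFin; apply: eq_bigr => t _.
  by rewrite big_ord_recl /= -/(M t); ring.
apply: eq_integral => x _.
transitivity (\int[mu]_(y in `[0%R, (2 * pi * Rr)%R]%classic)
    (\sum_(t <- r) (c t * M t * G t 0%N x) *
       cos (phi t + (th t 0%N)%:~R / Rr * y))%:E)%E; last first.
  rewrite integral_lin_comb //; last by move=> t; exact: integrable_cos_affine.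
  congr EFin; apply: eq_bigr => t _; rewrite Rintegral_cos_period //; ring.
apply: eq_integral => y _.
transitivity (iintZ n Rr (fun s => (\sum_(t <- r)
     c t * G t 0%N x * (\prod_(j < n) G t j.+1 (xco s j)) *
     cos (phi t + (th t 0%N)%:~R / Rr * y +
       \sum_(j < n) (th t j.+1)%:~R / Rr * (nth (0, 0) s j).2))%:E)).
  apply: eq_iintZ => s _; congr EFin; apply: eq_bigr => t _.
  by rewrite !big_ord_recl /= addrA mulrA.
rewrite (IHn (fun t => c t * G t 0%N x)
  (fun t => phi t + (th t 0%N)%:~R / Rr * y) (fun t j => G t j.+1)
  (fun t j => th t j.+1)) //.
by congr EFin; apply: eq_bigr => t _; rewrite -/(M t); ring.
Qed.

End Integrals.

Section GaussianKernel.
Context {R : realType}.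
Local Notation mu := (@lebesgue_measure R).
Variables (ell : R).
Hypothesis ell_gt0 : 0 < ell.

(** An unnormalised Gaussian of mean [a * ell ^+ 2 / 2] and variance [ell ^+ 2 / 2]; exponent [n] of
    one variable corresponds to [a = 2 * n / Rr]. *)
Definition gker (a x : R) : R := expR (a * x - x ^+ 2 / ell ^+ 2).

Let sd := ell / Num.sqrt 2.

Definition gker_mass : R := (normal_peak sd)^-1.

Let sd_gt0 : 0 < sd. Proof. by rewrite divr_gt0 // sqrtr_gt0. Qed.

Lemma gker_mass_gt0 : 0 < gker_mass.
Proof. by rewrite invr_gt0 normal_peak_gt0 // gt_eqF. Qed.

Let gkerE a x :
  gker a x = gker_mass * expR (a ^+ 2 * ell ^+ 2 / 4) *
             normal_pdf (a * ell ^+ 2 / 2) sd x.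
Proof.
rewrite normal_pdfE ?gt_eqF // /gker_mass /normal_fun.
have sd2 : sd ^+ 2 *+ 2 = ell ^+ 2.
  by rewrite /sd expr_div_n sqr_sqrtr // -mulr_natr divfK.
rewrite sd2; set pk := normal_peak sd; set E := expR (a ^+ 2 * _ / _).
have pk_neq0 : pk != 0 by rewrite gt_eqF // normal_peak_gt0 // gt_eqF.
have -> z : pk^-1 * E * (pk * z) = E * z by field.
by rewrite -expRD; congr expR; field; rewrite gt_eqF.
Qed.

Lemma measurable_gker a : measurable_fun [set: measurableTypeR R]%classic (gker a).
Proof.
rewrite (_ : gker a = fun x => gker_mass * expR (a ^+ 2 * ell ^+ 2 / 4) *
             normal_pdf (a * ell ^+ 2 / 2) sd x); last exact/funext/gkerE.
by apply: measurable_funM => //; exact: measurable_normal_pdf.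
Qed.

Lemma integrable_gker a : mu.-integrable [set: R]%classic (EFin \o gker a).
Proof.
rewrite (_ : EFin \o gker a = fun x => ((gker_mass *
    expR (a ^+ 2 * ell ^+ 2 / 4))%:E * (normal_pdf (a * ell ^+ 2 / 2) sd x)%:E)%E).
  by apply: integrableZl => //; exact: integrable_normal_pdf.
by apply/funext => x; rewrite /= gkerE EFinM.
Qed.

Lemma Rintegral_gker a :
  \int[mu]_x gker a x = gker_mass * expR (a ^+ 2 * ell ^+ 2 / 4).
Proof.
under eq_Rintegral do rewrite gkerE.
rewrite RintegralZl //; last exact: integrable_normal_pdf.
by rewrite /Rintegral integral_normal_pdf mulr1.
Qed.

Section Cutoff.
Variable h : R -> R.
Hypotheses (mh : measurable_fun [set: measurableTypeR R]%classic h)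
           (h01 : forall x, 0 <= h x <= 1).

Lemma integrable_cutoff_gker a :
  mu.-integrable [set: R]%classic (EFin \o (fun x => h x * gker a x)).
Proof.
apply: (le_integrable measurableT _ _ (integrable_gker a)).
  by apply/measurable_EFinP/measurable_funM => //; exact: measurable_gker.
move=> x _ /=; rewrite lee_fin normrM ler_piMl //.
by have /andP[h0 h1] := h01 x; rewrite ger0_norm.
Qed.

(** A Chernoff bound: the discarded part [1 - h] is dominated by an exponential tilt that recentres
    the Gaussian at the cut point [y * ell ^+ 2 / Rr], which yields the loss [expR (- ((ell / Rr) ^+
    2 * (y - n) ^+ 2))]. *)
Lemma Rintegral_cutoff_ge (Rr y n : R) : 0 < Rr ->
    (forall x, 1 - h x <= expR (2 * (y - n) / Rr * (x - y * ell ^+ 2 / Rr))) ->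
  gker_mass * expR ((ell / Rr) ^+ 2 * n ^+ 2) *
    (1 - expR (- ((ell / Rr) ^+ 2 * (y - n) ^+ 2))) <=
  \int[mu]_x (h x * gker (2 * n / Rr) x).
Proof.
move=> Rr_gt0 tail; have Rr_neq0 : Rr != 0 by rewrite gt_eqF.
pose b := y * ell ^+ 2 / Rr; pose s := 2 * (y - n) / Rr.
rewrite mulrBr mulr1 lerBlDl.
have -> : gker_mass * expR ((ell / Rr) ^+ 2 * n ^+ 2) = \int[mu]_x gker (2 * n / Rr) x.
  by rewrite Rintegral_gker; congr (_ * expR _); field.
have -> : \int[mu]_x gker (2 * n / Rr) x * expR (- ((ell / Rr) ^+ 2 * (y - n) ^+ 2)) =
    \int[mu]_x (expR (- s * b) * gker (2 * n / Rr + s) x).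
  rewrite RintegralZl //; last exact: integrable_gker.
  rewrite !Rintegral_gker [RHS]mulrCA -[LHS]mulrA -!expRD; congr (_ * expR _).
  by rewrite /s /b; field.
have int_tail : mu.-integrable [set: R]%classic
    (EFin \o (fun x => expR (- s * b) * gker (2 * n / Rr + s) x)).
  exact: (integrableZl measurableT (expR (- s * b)) (integrable_gker _)).
have int_cut := integrable_cutoff_gker (2 * n / Rr).
rewrite -RintegralD //; apply: le_Rintegral => //.
- exact: integrable_gker.
- exact: (integrableD measurableT int_tail int_cut).
move=> x _.
have -> : expR (- s * b) * gker (2 * n / Rr + s) x =
          expR (s * (x - b)) * gker (2 * n / Rr) x.
  by rewrite /gker -!expRD; congr expR; ring.
rewrite -mulrDl ler_peMl ?expR_ge0 // -lerBlDr; exact: tail.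
Qed.

End Cutoff.

End GaussianKernel.

(** * Expansion of the squared modulus of the wave function *)

Section PsiExpansion.
Variable R : realType.

Definition polar (a b : R) : R[i] := Complex (expR a * cos b) (expR a * sin b).

Lemma polarD (a b a' b' : R) : polar a b * polar a' b' = polar (a + a') (b + b').
Proof.
rewrite /polar cosD sinD expRD; apply/eqP; rewrite eq_complex /=.
by apply/andP; split; apply/eqP; ring.
Qed.

Lemma polar0 : polar 0 0 = 1.
Proof. by rewrite /polar expR0 cos0 sin0 mulr1 mulr0. Qed.

Lemma polarX (a b : R) n : polar a b ^+ n = polar (n%:R * a) (n%:R * b).
Proof.
elim: n => [|n IHn]; first by rewrite !mul0r polar0.
by rewrite exprSr IHn polarD -natr1 !mulrDl !mul1r.
Qed.

Lemma polar_sum (I : Type) (r : seq I) (a b : I -> R) :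
  \prod_(i <- r) polar (a i) (b i) = polar (\sum_(i <- r) a i) (\sum_(i <- r) b i).
Proof.
elim: r => [|i r IHr]; first by rewrite !big_nil polar0.
by rewrite !big_cons IHr polarD.
Qed.

Lemma cabs2M (z w : R[i]) : cabs2 (z * w) = cabs2 z * cabs2 w.
Proof. by case: z => a b; case: w => c d; rewrite /cabs2 /=; ring. Qed.

Lemma cabs2_real (x : R) : cabs2 (x%:C)%C = x ^+ 2.
Proof. by rewrite /cabs2 /= expr0n addr0. Qed.

Lemma cabs2_sum_polar (I : Type) (r : seq I) (c a b : I -> R) :
  cabs2 (\sum_(i <- r) (c i)%:C%C * polar (a i) (b i)) =
  \sum_(i <- r) \sum_(k <- r) c i * c k * expR (a i + a k) * cos (b i - b k).
Proof.
have -> : \sum_(i <- r) (c i)%:C%C * polar (a i) (b i) =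
    Complex (\sum_(i <- r) c i * expR (a i) * cos (b i))
            (\sum_(i <- r) c i * expR (a i) * sin (b i)).
  elim: r => [|i r IHr]; first by rewrite !big_nil.
  rewrite !big_cons IHr; apply/eqP; rewrite eq_complex /=.
  by apply/andP; split; apply/eqP; ring.
rewrite /cabs2 /= !expr2 !big_distrlr -big_split /=; apply: eq_bigr => i _.
rewrite -big_split /=; apply: eq_bigr => k _.
by rewrite cosB expRD; ring.
Qed.

Variables (N p : nat) (Rr ell kappa : R).
Local Notation V := (laughlin_poly R N p).

(** The wave function is the Laughlin polynomial evaluated at [exp (z_j / R)], times Gaussians. The
    phase is written [0 + ...] to match the form of the angular integration. *)
Lemma cabs2_Psi (s : seq (R * R)) : ell != 0 ->
  cabs2 (Psi N p Rr ell kappa s) = kappa ^+ 2 *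
  \sum_(m <- msupp V) \sum_(m' <- msupp V) V@_m * V@_m' *
    (\prod_(j < N) gker ell (((m j)%:R + (m' j)%:R) / Rr) (xco s j)) *
    cos (0 + \sum_(j < N)
           ((m j)%:Z - (m' j)%:Z)%:~R / Rr * (nth (0, 0) s j).2).
Proof.
move=> ell_neq0; pose u (j : 'I_N) := polar (xco s j / Rr) ((nth (0, 0) s j).2 / Rr).
have prodE : \prod_(j < N) \prod_(k < N | (j < k)%N)
      (cexp ((Rr^-1)%:C%C * zpt s k) - cexp ((Rr^-1)%:C%C * zpt s j)) ^+ p =
    mmap (real_complex R) u V.
  have cexpE j : cexp ((Rr^-1)%:C%C * zpt s j) =
      polar (xco s j / Rr) ((nth (0, 0) s j).2 / Rr).
    by rewrite /cexp /polar /zpt /xco /= !mul0r subr0 addr0 ![Rr^-1 * _]mulrC.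
  rewrite /laughlin_poly rmorph_prod; apply: eq_bigr => j _.
  rewrite rmorph_prod; apply: eq_bigr => k _.
  by rewrite rmorphXn rmorphB /= !mmapX !mmap1U !cexpE.
have -> : Psi N p Rr ell kappa s = (kappa%:C)%C * mmap (real_complex R) u V *
    ((expR (- (1 / (2 * ell ^+ 2)) * \sum_(k < N) xco s k ^+ 2))%:C)%C.
  by rewrite /Psi prodE.
rewrite !cabs2M !cabs2_real -mulrA; congr (_ * _).
have -> : mmap (real_complex R) u V = \sum_(m <- msupp V) (V@_m)%:C%C *
    polar (\sum_(j < N) (m j)%:R * (xco s j / Rr))
          (\sum_(j < N) (m j)%:R * ((nth (0, 0) s j).2 / Rr)).
  rewrite /mmap; apply: eq_bigr => m _; congr (_ * _).
  by rewrite /mmap1 -polar_sum; apply: eq_bigr => j _; rewrite polarX.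
rewrite cabs2_sum_polar mulr_suml; apply: eq_bigr => m _.
rewrite mulr_suml; apply: eq_bigr => m' _.
rewrite -mulrA [cos _ * _]mulrC mulrA; congr (_ * _).
  rewrite -mulrA; congr (_ * _); rewrite /gker -expR_sum -expRM_natl -expRD.
  congr expR; rewrite sumrB -big_split /= mulr_sumr mulr_sumr -sumrN.
  rewrite -[RHS]big_split -big_split /=; apply: eq_bigr => j _.
  rewrite -mulr_natl; set e := ell ^+ 2.
  have -> : 2 * (- (1 / (2 * e)) * xco s j ^+ 2) = - (xco s j ^+ 2 / e).
    by field; rewrite expf_neq0.
  by ring.
rewrite add0r; congr cos; rewrite -sumrB; apply: eq_bigr => j _.
by rewrite rmorphB /=; ring.
Qed.

End PsiExpansion.

(** Two distinct exponents differ at some particle, whose angular integral vanishes, so only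
    diagonal terms survive. The family [h] indexed by [L] covers both the event and the
    normalisation. *)
Lemma iintZ_laughlin (R : realType) (N p : nat) (Rr ell kappa : R) (I : Type)
    (L : seq I) (h : I -> nat -> R -> R) : 0 < Rr -> 0 < ell ->
    (forall i j, measurable_fun [set: measurableTypeR R]%classic (h i j)) ->
    (forall i j x, 0 <= h i j x <= 1) ->
  iintZ N Rr (fun s => ((\sum_(i <- L) \prod_(j < N) h i j (xco s j)) *
                        cabs2 (Psi N p Rr ell kappa s))%:E) =
  (kappa ^+ 2 * (2 * pi * Rr) ^+ N *
   \sum_(i <- L) \sum_(m <- msupp (laughlin_poly R N p))
     (laughlin_poly R N p)@_m ^+ 2 *
     \prod_(j < N) \int[@lebesgue_measure R]_x
        (h i j x * gker ell (2 * (m j)%:R / Rr) x))%:E.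
Proof.
move=> Rr_gt0 ell_gt0 mh h01; set V := laughlin_poly R N p.
pose r := [seq (i, mm) | i <- L, mm <- [seq (m, m') | m <- msupp V, m' <- msupp V]].
pose c (t : I * ('X_{1..N} * 'X_{1..N})) : R := kappa ^+ 2 * (V@_t.2.1 * V@_t.2.2).
pose G (t : I * ('X_{1..N} * 'X_{1..N})) j x := h t.1 j x *
  gker ell (((nth 0%N t.2.1 j)%:R + (nth 0%N t.2.2 j)%:R) / Rr) x.
pose th (t : I * ('X_{1..N} * 'X_{1..N})) j : int :=
  (nth 0%N t.2.1 j)%:Z - (nth 0%N t.2.2 j)%:Z.
rewrite (@eq_iintZ _ _ _ _ (fun s => (\sum_(t <- r)
     c t * (\prod_(j < N) G t j (xco s j)) *
     cos (0 + \sum_(j < N) (th t j)%:~R / Rr * (nth (0, 0) s j).2))%:E)).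
  rewrite (iintZ_trig r N Rr_gt0 c (fun=> 0)); last first.
    by move=> t j; exact: integrable_cutoff_gker.
  congr EFin; rewrite /r big_allpairs /= mulr_sumr; apply: eq_bigr => i _.
  rewrite big_allpairs mulr_sumr big_seq [RHS]big_seq; apply: eq_bigr => m mV.
  rewrite [LHS](bigD1_seq m) ?msupp_uniq //= [X in _ + X]big1_seq => [|m' /andP[ne _]]; last first.
    have [j nj] : exists j : 'I_N, m j != m' j.
      apply/existsP; apply: contraR ne; rewrite negb_exists => /forallP mm'.
      by apply/eqP/mnmP => j; apply/esym/eqP; have := mm' j; rewrite negbK.
    rewrite (bigD1 j) //= /th /= -!(mnm_nth 0%N) subr_eq0 eqz_nat (negPf nj).
    by rewrite mulr0 !mul0r mulr0 mul0r.
  rewrite addr0 cos0 mulr1 /c /=.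
  have -> : \prod_(j < N) (2 * pi * Rr * (th (i, (m, m)) j == 0)%:R *
        \int[lebesgue_measure]_x G (i, (m, m)) j x) =
      (2 * pi * Rr) ^+ N * \prod_(j < N) \int[lebesgue_measure]_x
        (h i j x * gker ell (2 * (m j)%:R / Rr) x).
    rewrite -[X in _ ^+ X]card_ord -prodr_const -big_split /=.
    apply: eq_bigr => j _; rewrite /th /= subrr eqxx mulr1; congr (_ * _).
    rewrite /G /= -!(mnm_nth 0%N).
    by have -> : (m j)%:R + (m j)%:R = 2 * (m j)%:R :> R by ring.
  by rewrite expr2; ring.
move=> s _; congr EFin.
rewrite cabs2_Psi ?gt_eqF // /r big_allpairs /= mulr_suml; apply: eq_bigr => i _.
rewrite big_allpairs /= mulrCA mulr_sumr mulr_sumr; apply: eq_bigr => m _.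
rewrite mulr_sumr mulr_sumr; apply: eq_bigr => m' _.
rewrite /c /G /= big_split /=.
have -> : \prod_(j < N) gker ell (((m j)%:R + (m' j)%:R) / Rr) (xco s j) =
    \prod_(j < N) gker ell (((nth 0%N m j)%:R + (nth 0%N m' j)%:R) / Rr) (xco s j).
  by apply: eq_bigr => j _; rewrite -!(mnm_nth 0%N).
rewrite /th /=.
have -> : \sum_(j < N) ((m j)%:Z - (m' j)%:Z)%:~R / Rr * (nth (0, 0) s j).2 =
    \sum_(j < N) ((nth 0%N m j)%:Z - (nth 0%N m' j)%:Z)%:~R / Rr * (nth (0, 0) s j).2.
  by apply: eq_bigr => j _; rewrite -!(mnm_nth 0%N).
by ring.
Qed.

(** * Splitting the event by the set of particles left of the cut *)

Section Cut.
Variables (R : realType) (N : nat) (xbar : R).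

(** The particle index is a natural number, as in the cutoffs of [iintZ_laughlin]; membership in [S]
    is therefore tested on values. *)
Definition cut (S : {set 'I_N}) (j : nat) (x : R) : R :=
  if j \in [seq val i | i <- enum S] then (x <= xbar)%R%:R else (xbar < x)%R%:R.

Lemma cutE (S : {set 'I_N}) (j : 'I_N) x :
  cut S j x = if j \in S then (x <= xbar)%R%:R else (xbar < x)%R%:R.
Proof. by rewrite /cut mem_map ?mem_enum //; exact: val_inj. Qed.

Lemma cut_ge0_le1 S j x : 0 <= cut S j x <= 1.
Proof.
by rewrite /cut; case: ifP => _; [case: (x <= xbar) | case: (xbar < x)];
  rewrite ?lexx ?ler01.
Qed.

Lemma measurable_cut S j : measurable_fun [set: measurableTypeR R]%classic (cut S j).
Proof.
rewrite /cut; case: (j \in _).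
  rewrite (_ : (fun x => _) = \1_(`]-oo, xbar]%classic)); last first.
    by apply/funext => x; rewrite indicE mem_setE in_itv.
  exact: measurable_indic.
rewrite (_ : (fun x => _) = \1_(`]xbar, +oo[%classic)); last first.
  by apply/funext => x; rewrite indicE mem_setE in_itv /= andbT.
exact: measurable_indic.
Qed.

(** Among all [S], only the actual set of particles left of [xbar] has a nonzero product. *)
Lemma Kexcess_eq0E (k : nat) (s : seq (R * R)) :
  (Kexcess N k xbar s == 0)%:R =
  \sum_(S : {set 'I_N} | #|S| == k) \prod_(j < N) cut S j (xco s j).
Proof.
pose S0 := [set j : 'I_N | xco s j <= xbar].
have -> : (Kexcess N k xbar s == 0) = (#|S0| == k).
  rewrite /Kexcess subr_eq0 eqz_nat; congr (_ == _); apply: eq_card => j.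
  by rewrite [RHS]inE; apply/idP/idP; rewrite in_setE.
have prodE S : \prod_(j < N) cut S j (xco s j) = (S == S0)%:R.
  case: eqP => [->|SS0].
    by rewrite big1 // => j _; rewrite cutE inE; case: leP.
  have [j nj] : exists j : 'I_N, (j \in S) != (j \in S0).
    apply/existsP; apply: contra_notT SS0; rewrite negb_exists => /forallP SS0.
    by apply/setP => j; apply/eqP; have := SS0 j; rewrite negbK.
  rewrite (bigD1 j) //= cutE; move: nj; rewrite [j \in S0]inE.
  case: (j \in S); first by case: (_ <= _) => // _; rewrite mul0r.
  by case: leP => // _; rewrite ?mul0r.
under eq_bigr do rewrite prodE.
rewrite big_mkcond (bigD1 S0) //= eqxx big1 => [|S /negPf ->]; last by rewrite if_same.
by rewrite addr0; case: ifP.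
Qed.

End Cut.

Lemma exists_ordered_at (N k : nat) (m : 'X_{1..N}) : (k <= N)%N ->
  exists2 S : {set 'I_N}, #|S| = k & ordered_at S m.
Proof.
move=> kN; pose s := sort (fun i j : 'I_N => (m i <= m j)%N) (enum 'I_N).
have us : uniq s by rewrite sort_uniq enum_uniq.
have sz : size s = N by rewrite size_sort size_enum_ord.
exists [set i in take k s].
  by rewrite cardsE (card_uniqP _) ?take_uniq // size_takel ?sz.
have : pairwise (fun i j : 'I_N => (m i <= m j)%N) (take k s ++ drop k s).
  rewrite cat_take_drop -sorted_pairwise; first by apply: sort_sorted => i j; exact: leq_total.
  by move=> j i l; exact: leq_trans.
rewrite pairwise_cat => /and3P[/allrelP H _ _].
apply/forall_inP => i; rewrite inE => iS; apply/forall_inP => j; rewrite !inE => jS.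
apply: H => //; have : j \in take k s ++ drop k s.
  by rewrite cat_take_drop mem_sort mem_enum.
by rewrite mem_cat (negPf jS).
Qed.

Lemma laughlin_poly_neq0 (R : realType) (N p : nat) : laughlin_poly R N p != 0.
Proof.
apply/prodf_neq0 => j _; apply/prodf_neq0 => k jk; apply: expf_neq0.
apply/eqP => /(congr1 (mcoeff U_(k))); rewrite mcoeffB !mcoeffXU mcoeff0 eqxx.
have /negPf -> : j != k by apply: contraTneq jk => ->; rewrite ltnn.
by rewrite subr0 => /eqP; rewrite oner_eq0.
Qed.

(** Each power [x] is at most [q], so [1 - x >= expR (- (x / (1 - q)))], and the exponents sum to a
    geometric series. *)
Lemma prod_one_sub_srank_ge (R : realType) (I : finType) (S : {set I})
    (D : I -> R) (q : R) : 0 <= q -> q < 1 ->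
  expR (- (q / (1 - q) ^+ 2)) <= \prod_(i in S) (1 - q ^+ (srank S D i).+1).
Proof.
move=> q_ge0 q_lt1; have subq_gt0 : 0 < 1 - q by rewrite subr_gt0.
apply: le_trans (_ : _ <= \prod_(i in S) expR (- (q ^+ (srank S D i).+1 / (1 - q)))) _.
  rewrite -expR_sum ler_expR sumrN lerN2 -mulr_suml.
  under eq_bigr do rewrite exprS.
  rewrite -mulr_sumr expr2 invfM mulrA ler_pdivrMr // divfK ?gt_eqF //.
  by rewrite ler_wpM2l // sum_srank_geometric.
apply: ler_prod => i _; rewrite expR_ge0 /=.
set x := q ^+ _.
have x_le : x <= q by rewrite /x exprS ler_piMr // exprn_ile1 // ltW.
have subx_gt0 : 0 < 1 - x by lra.
rewrite expRN -[leRHS]invrK lef_pV2 ?posrE ?expR_gt0 ?invr_gt0 //.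
apply: le_trans (expR_ge1Dx _).
have x_ge0 : 0 <= x by rewrite exprn_ge0.
have -> : (1 - x)^-1 = 1 + x / (1 - x) by field; rewrite gt_eqF.
rewrite lerD2l ler_wpM2l // lef_pV2 ?posrE //; lra.
Qed.

(** * Gaussian localisation at the renewal exponents *)

Section BulkProbability.
Variables (R : realType) (N p : nat) (Rr ell : R).
Hypotheses (p_gt0 : (0 < p)%N) (Rr_gt0 : 0 < Rr) (ell_gt0 : 0 < ell).
Variables (S : {set 'I_N}) (m' : 'X_{1..N}).
Hypothesis m'B : m' \in msupp (block_poly R p S).

Let m := bulk_mnm p S m'.
(** The cut in units of [ell ^+ 2 / Rr], midway between [p (k - 1)] and [p k]: distances to it are
    [Dl] or [Dr] plus [p / 2], which turns a rank into its successor. *)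
Let y : R := (#|S|%:R - 1 / 2) * p%:R.
Let gam := ell / Rr.
Let q := expR (- (gam ^+ 2 * p%:R ^+ 2 / 4)).
Let Dl i : R := p%:R * (#|S|%:R - 1) - (m i)%:R.
Let Dr i : R := (m i)%:R - p%:R * #|S|%:R.

Let p2_gt0 : 0 < p%:R / 2 :> R. Proof. by rewrite divr_gt0 ?ltr0n. Qed.

Let q_ge0 : 0 <= q. Proof. exact: expR_ge0. Qed.

Let q_lt1 : q < 1.
Proof.
by rewrite expR_lt1 oppr_lt0 divr_gt0 // mulr_gt0 // exprn_gt0 // ?divr_gt0 ?ltr0n.
Qed.

Let Dl_ge i : i \in S -> p%:R / 2 * (srank S Dl i)%:R <= Dl i.
Proof. by move=> iS; apply: srank_le => // A AS; exact: msupp_block_maj_l. Qed.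

Let Dr_ge i : i \in ~: S -> p%:R / 2 * (srank (~: S) Dr i)%:R <= Dr i.
Proof. by move=> iS; apply: srank_le => // A AS; exact: msupp_block_maj_r. Qed.

Let tail_le (d : R) (k : nat) : p%:R / 2 * k.+1%:R <= d ->
  expR (- (gam ^+ 2 * d ^+ 2)) <= q ^+ k.+1.
Proof.
move=> dk; rewrite -expRM_natl ler_expR mulrN lerN2.
have -> : k.+1%:R * (gam ^+ 2 * p%:R ^+ 2 / 4) = gam ^+ 2 * ((p%:R / 2) ^+ 2 * k.+1%:R).
  by field.
rewrite ler_wpM2l ?sqr_ge0 //.
(* Bounding the square of [k.+1] below by [k.+1] weakens Gaussian decay to geometric decay. *)
apply: le_trans (_ : _ <= (p%:R / 2 * k.+1%:R) ^+ 2) _.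
  rewrite [leRHS]exprMn ler_wpM2l ?sqr_ge0 // expr2 ler_peMl ?ler0n //.
  by rewrite ler1n.
have pk_ge0 : 0 <= p%:R / 2 * k.+1%:R :> R by rewrite mulr_ge0 ?ler0n // ltW.
by rewrite ler_pXn2r // nnegrE // (le_trans pk_ge0).
Qed.

Let tau i : R := expR (- (gam ^+ 2 * (y - (m i)%:R) ^+ 2)).

Let tau_l i : i \in S -> tau i <= q ^+ (srank S Dl i).+1.
Proof.
move=> iS; apply: tail_le; have := Dl_ge iS.
by rewrite -(natr1 (srank S _ _)) /Dl /y; lra.
Qed.

Let tau_r i : i \in ~: S -> tau i <= q ^+ (srank (~: S) Dr i).+1.
Proof.
move=> iS; rewrite /tau -[(y - _) ^+ 2]sqrrN opprB; apply: tail_le.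
have := Dr_ge iS.
by rewrite -(natr1 (srank (~: S) _ _)) /Dr /y; lra.
Qed.

Let prod_tau_ge : expR (- (q / (1 - q) ^+ 2)) ^+ 2 <= \prod_(i < N) (1 - tau i).
Proof.
have factor_ge0 k : 0 <= 1 - q ^+ k by rewrite subr_ge0 exprn_ile1 // ltW.
rewrite (bigID (mem S)) /= expr2; apply: ler_pM; rewrite ?expR_ge0 //.
  apply: le_trans (prod_one_sub_srank_ge S Dl q_ge0 q_lt1) _.
  by apply: ler_prod => i iS; rewrite factor_ge0 /= lerB // tau_l.
apply: le_trans (prod_one_sub_srank_ge (~: S) Dr q_ge0 q_lt1) _.
rewrite (eq_bigl (fun i => i \notin S)) => [|i]; last by rewrite inE.
by apply: ler_prod => i iS; rewrite factor_ge0 /= lerB // tau_r // inE.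
Qed.

Lemma bulk_cut_prob_ge :
  gker_mass ell ^+ N * mnm_weight (gam ^+ 2) m *
    expR (- (q / (1 - q) ^+ 2)) ^+ 2 <=
  \prod_(j < N) \int[@lebesgue_measure R]_x
    (cut (y * ell ^+ 2 / Rr) S j x * gker ell (2 * (m j)%:R / Rr) x).
Proof.
have mass_gt0 := gker_mass_gt0 ell_gt0.
apply: le_trans (_ : _ <= \prod_(j < N) (gker_mass ell *
    expR (gam ^+ 2 * (m j)%:R ^+ 2) * (1 - tau j))) _.
  rewrite !big_split /= prodr_const card_ord -expR_sum -mulr_sumr.
  by rewrite ler_wpM2l // mulr_ge0 ?expR_ge0 // exprn_ge0 // ltW.
apply: ler_prod => j _; apply/andP; split.
  rewrite !mulr_ge0 ?expR_ge0 ?(ltW mass_gt0) //.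
  by rewrite subr_ge0 expR_le1 oppr_le0 mulr_ge0 ?sqr_ge0.
apply: Rintegral_cutoff_ge => //.
- exact: measurable_cut.
- by move=> x; exact: cut_ge0_le1.
move=> x; rewrite cutE.
(* On the wrong side of the cut [y - m j] and [x - xbar] have the same sign, so the tilt is at least
   1; on the right side [1 - cut] is zero. *)
have expR1 (a b : R) : 0 <= a * b -> 1 <= expR (2 * a / Rr * b).
  move=> ab; rewrite -[leLHS]expR0 ler_expR.
  have -> : 2 * a / Rr * b = 2 * (a * b) / Rr by ring.
  by apply: divr_ge0; [apply: mulr_ge0 | exact: ltW].
case: (boolP (j \in S)) => jS; case: (leP x _) => xb;
  rewrite ?subrr ?expR_ge0 ?subr0 //; apply: expR1.
  apply: mulr_ge0; last by rewrite subr_ge0 ltW.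
  have := Dl_ge jS; have : 0 <= p%:R / 2 * (srank S Dl j)%:R :> R.
    by rewrite mulr_ge0 // ltW.
  by have := p2_gt0; rewrite /Dl /y; lra.
apply: mulr_le0; last by rewrite subr_le0.
have jS' : j \in ~: S by rewrite inE.
have := Dr_ge jS'; have : 0 <= p%:R / 2 * (srank (~: S) Dr j)%:R :> R.
  by rewrite mulr_ge0 // ltW.
by have := p2_gt0; rewrite /Dr /y; lra.
Qed.

End BulkProbability.

(** * Comparing the event with the normalisation *)

Theorem theorem5p3 (R : realType) (p : nat) (gamma : R) :
  (0 < p)%N -> 0 < gamma ->
  exists c : R, 0 < c /\
    forall (Rr ell : R), 0 < Rr -> 0 < ell -> gamma = ell / Rr ->
    forall (N : nat) (kappa : R), (2 <= N)%N -> 0 < kappa ->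
    forall k : nat, (1 <= k <= N - 1)%N ->
      let xbar := (k%:R - 1 / 2) * p%:R * ell ^+ 2 / Rr in
      1 / c <= PN N p Rr ell kappa
                 (fun s => Kexcess N k xbar s == 0).
Proof.
move=> p_gt0 gamma_gt0.
pose g := gamma ^+ 2; have g_gt0 : 0 < g by rewrite exprn_gt0.
pose q1 := expR (- (g * p%:R / 8)).
pose C := expR (p%:R * (q1 / (1 - q1)) ^+ 2).
pose q2 := expR (- (g * p%:R ^+ 2 / 4)).
pose c2 := expR (- (q2 / (1 - q2) ^+ 2)) ^+ 2.
have c2_gt0 : 0 < c2 by rewrite exprn_gt0 ?expR_gt0.
have C2_gt0 : 0 < C ^+ 2 by rewrite exprn_gt0 ?expR_gt0.
(* [C ^+ 2] is the loss in the Schur test and [c2] the localisation probability; both depend only on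
   [p] and [gamma]. *)
exists (C ^+ 2 / c2); split; first exact: divr_gt0.
move=> Rr ell Rr_gt0 ell_gt0 gammaE N kappa _ kappa_gt0 k /andP[_ kN].
cbv zeta; set xbar : R := (_ - _) * _ * _ / _.
have {}kN : (k <= N)%N by apply: leq_trans kN _; exact: leq_subr.
pose V := laughlin_poly R N p.
pose w (m : 'X_{1..N}) := V@_m ^+ 2 * mnm_weight g m.
have w_ge0 m : 0 <= w m by rewrite mulr_ge0 ?sqr_ge0 ?expR_ge0.
pose K := kappa ^+ 2 * (2 * pi * Rr) ^+ N; pose M := gker_mass ell ^+ N.
have mass_gt0 := gker_mass_gt0 ell_gt0.
have K_gt0 : 0 < K by rewrite mulr_gt0 ?exprn_gt0 // !mulr_gt0 ?pi_gt0.
have M_gt0 : 0 < M by rewrite exprn_gt0.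
(* The total weight of the renewal exponents, to which both integrals are compared. *)
pose A := \sum_(S : {set 'I_N} | #|S| == k) \sum_(m <- msupp (block_poly R p S))
  (block_poly R p S)@_m ^+ 2 * mnm_weight g (bulk_mnm p S m).
have den : iintZ N Rr (fun s => (cabs2 (Psi N p Rr ell kappa s))%:E) =
    (K * (M * \sum_(m <- msupp V) w m))%:E.
  rewrite (@eq_iintZ _ _ _ _ (fun s => ((\sum_(i <- [:: tt]) \prod_(j < N) 1) *
      cabs2 (Psi N p Rr ell kappa s))%:E)); last first.
    by move=> s _; rewrite big_seq1 big1 ?mul1r.
  rewrite (@iintZ_laughlin _ _ _ _ _ _ _ _ (fun _ _ _ => 1)) //; last first.
    by move=> *; rewrite ler01 lexx.
  rewrite -/K big_seq1 [M * _]mulr_sumr; congr (_ * _)%:E.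
  apply: eq_bigr => m _; rewrite -/V /w mulrCA; congr (_ * _).
  rewrite /M -[X in _ ^+ X]card_ord -prodr_const /mnm_weight mulr_sumr expR_sum.
  rewrite -big_split /=; apply: eq_bigr => j _.
  under eq_Rintegral do rewrite mul1r.
  rewrite Rintegral_gker //; congr (_ * expR _); rewrite /g gammaE.
  by field; rewrite gt_eqF.
(* For each [S] only the renewal exponents are kept; the other terms are nonnegative. *)
have num : exists2 X : R, K * (M * (c2 * A)) <= X &
    iintZ N Rr (fun s => ((Kexcess N k xbar s == 0)%:R *
      cabs2 (Psi N p Rr ell kappa s))%:E) = X%:E.
  rewrite (@eq_iintZ _ _ _ _ (fun s =>
      ((\sum_(S <- [seq S : {set 'I_N} <- index_enum _ | #|S| == k])
          \prod_(j < N) cut xbar S j (xco s j)) *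
      cabs2 (Psi N p Rr ell kappa s))%:E)); last first.
    by move=> s _; rewrite Kexcess_eq0E big_filter.
  rewrite iintZ_laughlin //; last first.
  - by move=> *; exact: cut_ge0_le1.
  - by move=> *; exact: measurable_cut.
  eexists; last by [].
  rewrite -/K ler_wpM2l ?(ltW K_gt0) // big_filter /= mulr_sumr mulr_sumr.
  apply: ler_sum => S /eqP Sk.
  pose F (m : 'X_{1..N}) := V@_m ^+ 2 * \prod_(j < N)
    \int[@lebesgue_measure R]_x (cut xbar S j x * gker ell (2 * (m j)%:R / Rr) x).
  apply: le_trans (_ : _ <= \sum_(m <- [seq bulk_mnm p S m' |
      m' <- msupp (block_poly R p S)]) F m) _.
    rewrite [leRHS]big_map mulr_sumr mulr_sumr big_seq [leRHS]big_seq.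
    apply: ler_sum => m' m'B; rewrite /F mcoeff_laughlin_bulk //.
    have := @bulk_cut_prob_ge R N p Rr ell p_gt0 Rr_gt0 ell_gt0 S m' m'B.
    rewrite -gammaE Sk -/g -/q2 -/c2 -/M -/xbar => H.
    rewrite (_ : M * _ = (block_poly R p S)@_m' ^+ 2 *
      (M * mnm_weight g (bulk_mnm p S m') * c2)); last by ring.
    by rewrite ler_wpM2l ?sqr_ge0.
  apply: ler_sum_support.
  - rewrite map_inj_uniq ?msupp_uniq // => m1 m2.
    by rewrite /bulk_mnm => /addIm.
  - exact: msupp_uniq.
  - move=> m; rewrite mulr_ge0 ?sqr_ge0 // prodr_ge0 // => j _.
    apply: Rintegral_ge0 => x _; rewrite mulr_ge0 ?expR_ge0 //.
    by case/andP: (cut_ge0_le1 xbar S j x).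
  - move=> m _; rewrite mcoeff_msupp; apply: contraNneq => Vm.
    by rewrite /F Vm expr0n mul0r.
have [X X_ge numE] := num.
rewrite /PN numE den /=.
have sum_w_gt0 : 0 < \sum_(m <- msupp V) w m.
  have [m mV] : exists m, m \in msupp V.
    have := laughlin_poly_neq0 R N p; rewrite -msupp_eq0 -/V.
    by case: (msupp V) => // m s _; exists m; rewrite mem_head.
  rewrite (bigD1_seq m) ?msupp_uniq //= ltr_pwDl ?sumr_ge0 //.
  by rewrite mulr_gt0 ?expR_gt0 // exprn_even_gt0 //= -mcoeff_msupp.
rewrite ler_pdivlMr; last by apply: mulr_gt0 => //; exact: mulr_gt0.
apply: le_trans X_ge.
have sum_w_le : \sum_(m <- msupp V) w m <= C ^+ 2 * A.
  (* Every exponent is ordered at some [S] of size [k]; with ties it may be counted several times,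
     which only enlarges the upper bound. *)
  apply: le_trans (_ : _ <= \sum_(m <- msupp V)
      \sum_(S : {set 'I_N} | (#|S| == k) && ordered_at S m) w m) _.
    apply: ler_sum => m _; have [S Sk Sm] := exists_ordered_at m kN.
    by rewrite (bigD1 S) ?Sk ?eqxx //= lerDl sumr_ge0.
  rewrite (exchange_big_dep (fun S : {set 'I_N} => #|S| == k)) /=; last first.
    by move=> m S _ /andP[].
  rewrite mulr_sumr; apply: ler_sum => S Sk.
  under eq_bigl do rewrite Sk.
  exact: ordered_sum_le.
rewrite invf_div mul1r mulrCA ler_wpM2l ?(ltW K_gt0) // mulrCA.
rewrite ler_wpM2l ?(ltW M_gt0) // -mulrA ler_wpM2l ?(ltW c2_gt0) //.
by rewrite mulrC ler_pdivrMr // mulrC.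
Qed.
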